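(* Let $n\ge1$, let $\mathbb B^n$ be the open Euclidean unit ball and $\phi(x):=-\frac12\log(1-|x|^2)$. For all $x,y\in\mathbb B^n$, $$\lVert(d\phi)_x\rVert_{\alpha^*}=|x|<1,\qquad d_{\mathrm F}(x,y)=d_{\mathrm K}(x,y)+\phi(y)-\phi(x),$$ and, with $d_{\mathrm F}^{\mathrm s}(x,y):=\max\{d_{\mathrm F}(x,y),d_{\mathrm F}(y,x)\}$, $$d_{\mathrm F}^{\mathrm s}(x,y)=d_{\mathrm K}(x,y)+|\phi(y)-\phi(x)|.$$ Moreover, for every $b>0$ the triple $(\mathbb B^n,d_{\mathrm F},\mu_{n,b})$ is a qm-space, and $$\operatorname{Lip}^+_1(\mathbb B^n,d_{\mathrm F})=\phi+\operatorname{Lip}_1(\mathbb B^n,d_{\mathrm K}).$$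
   Context: For $x\in\mathbb B^n$, $v\in\mathbb R^n$, the Klein norm and forward Funk norm are $$\alpha_x(v):=\frac{\sqrt{(1-|x|^2)|v|^2+\langle x,v\rangle^2}}{1-|x|^2},\qquad F_x(v):=\frac{\sqrt{(1-|x|^2)|v|^2+\langle x,v\rangle^2}+\langle x,v\rangle}{1-|x|^2}.$$ $d_{\mathrm K}(x,y)$ (resp. $d_{\mathrm F}(x,y)$) is the infimum of $\int\alpha_{c}(\dot c)\,dt$ (resp. $\int F_c(\dot c)\,dt$) over piecewise $C^1$ curves $c$ in $\mathbb B^n$ from $x$ to $y$. $\lVert\cdot\rVert_{\alpha^*}$ at $x$ is the norm on covectors dual to $\alpha_x$. For $b>0$, $d\mu_{n,b}(x):=\frac{\Gamma(n/2+b)}{\pi^{n/2}\Gamma(b)}(1-|x|^2)^{b-1}dx$ on $\mathbb B^n$. A qm-space is a triple $(X,d_X,\mu_X)$ where $d_X\colon X\times X\to[0,+\infty)$ satisfies $d_X(x,x)=0$ and the triangle inequality (symmetry not required), $d_X^{\mathrm s}(x,y):=\max\{d_X(x,y),d_X(y,x)\}$ is a complete separable metric, and $\mu_X$ is a Borel probability measure on $(X,d_X^{\mathrm s})$ with full support. $\operatorname{Lip}^+_1(X,d_X)$ is the set of $f\colon X\to\mathbb R$ with $f(y)-f(x)\le d_X(x,y)$ for all $x,y\in X$; $\operatorname{Lip}_1$ denotes ordinary real-valued $1$-Lipschitz functions. *)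

(* Defs.v *)
From HB Require Import structures.
From mathcomp Require Import all_boot all_order all_algebra.
From mathcomp Require Import all_classical all_reals all_analysis.
Import Order.TTheory GRing.Theory Num.Theory.
Import numFieldNormedType.Exports.

Set Implicit Arguments.
Unset Strict Implicit.
Unset Printing Implicit Defensive.

Local Open Scope classical_set_scope.
Local Open Scope ring_scope.

(* The library norm of 'rV[R]_n is the sup norm, hence the separate Euclidean
   norm below; the topology and the differentials are the same for both. *)
Definition dot (R : realType) (n : nat) (x y : 'rV[R]_n) : R :=
  \sum_i x ord0 i * y ord0 i.

Definition enorm (R : realType) (n : nat) (x : 'rV[R]_n) : R :=
  Num.sqrt (dot x x).

Lemma enorm0_lt1 (R : realType) (n : nat) : enorm (0 : 'rV[R]_n) < 1.
Proof.
rewrite /enorm /dot big1 ?sqrtr0 ?ltr01// => i _.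
by rewrite mxE mul0r.
Qed.

Definition unit_ball (R : realType) (n : nat) : Type :=
  {x : 'rV[R]_n | enorm x < 1}.

HB.instance Definition _ (R : realType) (n : nat) :=
  Choice.on (unit_ball R n).
HB.instance Definition _ (R : realType) (n : nat) :=
  isPointed.Build (unit_ball R n) (exist _ 0 (enorm0_lt1 R n)).

Definition klein_norm (R : realType) (n : nat) (x v : 'rV[R]_n) : R :=
  Num.sqrt ((1 - enorm x ^+ 2) * enorm v ^+ 2 + dot x v ^+ 2)
    / (1 - enorm x ^+ 2).

Definition funk_norm (R : realType) (n : nat) (x v : 'rV[R]_n) : R :=
  (Num.sqrt ((1 - enorm x ^+ 2) * enorm v ^+ 2 + dot x v ^+ 2) + dot x v)
    / (1 - enorm x ^+ 2).

Definition dual_norm (R : realType) (n : nat) (N xi : 'rV[R]_n -> R) : R :=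
  sup [set `|xi v| | v in [set v | N v <= 1]].

(* C^1 on the closed interval: the derivative on the open interval extends
   continuously to the end points. *)
Definition C1_on (R : realType) (n : nat) (c : R -> 'rV[R]_n) (a b : R) : Prop :=
  [/\ {within `[a, b], continuous c},
      {in `]a, b[, forall t, derivable c t 1} &
      exists2 dc : R -> 'rV[R]_n, {within `[a, b], continuous dc} &
        {in `]a, b[, derive1 c =1 dc}].

Definition piecewise_C1 (R : realType) (n : nat) (c : R -> 'rV[R]_n)
    (a b : R) : Prop :=
  {within `[a, b], continuous c} /\
  exists2 s : seq R, itv_partition a b s &
    forall i, (i < size s)%N -> C1_on c (nth b (a :: s) i) (nth b s i).

Definition curve_dist (R : realType) (n : nat) (N : 'rV[R]_n -> 'rV[R]_n -> R)
    (x y : unit_ball R n) : R :=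
  inf [set l : R | exists (a b : R) (c : R -> 'rV[R]_n),
    [/\ a < b, piecewise_C1 c a b,
        {in `[a, b], forall t, enorm (c t) < 1},
        c a = val x /\ c b = val y &
        l = \int[lebesgue_measure]_(t in `[a, b]) N (c t) (derive1 c t)]].

Definition klein_dist (R : realType) (n : nat) : unit_ball R n -> unit_ball R n -> R :=
  curve_dist (@klein_norm R n).

Definition funk_dist (R : realType) (n : nat) : unit_ball R n -> unit_ball R n -> R :=
  curve_dist (@funk_norm R n).

Definition phi (R : realType) (n : nat) (x : 'rV[R]_n) : R :=
  - (1 / 2 * ln (1 - enorm x ^+ 2)).

Definition symmetrized (R : realType) (X : Type) (d : X -> X -> R) (x y : X) : R :=
  Num.max (d x y) (d y x).

Record is_metric (R : realType) (X : Type) (rho : X -> X -> R) : Prop := {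
  is_metric_xx : forall x, rho x x = 0 ;
  is_metric_eq : forall x y, rho x y = 0 -> x = y ;
  is_metric_sym : forall x y, rho x y = rho y x ;
  is_metric_triangle : forall y x z, rho x z <= rho x y + rho y z
}.

Definition metric_of (R : realType) (X : pointedType) (rho : X -> X -> R)
  (h : is_metric rho) : Type := X.

Section metric_of.
Variables (R : realType) (X : pointedType) (rho : X -> X -> R).
Variable h : is_metric rho.

HB.instance Definition _ := Pointed.on (metric_of h).
HB.instance Definition _ := isMetric.Build R (metric_of h)
  (is_metric_xx h) (is_metric_eq h) (is_metric_sym h) (is_metric_triangle h).

End metric_of.

(* [qm_mu] is given as a function on all subsets, and only its values on the
   Borel sets matter. *)
Record is_qm_space (R : realType) (X : pointedType) (d : X -> X -> R)
    (mu : set X -> \bar R) : Prop := {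
  qm_ge0 : forall x y, 0 <= d x y ;
  qm_xx : forall x, d x x = 0 ;
  qm_triangle : forall x y z, d x z <= d x y + d y z ;
  qm_metric : is_metric (symmetrized d) ;
  qm_complete : forall F : set_system (metric_of qm_metric),
    ProperFilter F -> cauchy F -> cvg F ;
  qm_separable : exists2 D : set (metric_of qm_metric), countable D & dense D ;
  qm_probability :
    exists P : probability
        (g_sigma_algebraType (@open (metric_of qm_metric))) R,
      forall A, <<s @open (metric_of qm_metric) >> A -> P A = mu A ;
  qm_full_support : forall U : set (metric_of qm_metric),
    open U -> U !=set0 -> (0 < mu U)%E
}.

Definition Lip1_fwd (R : realType) (X : Type) (d : X -> X -> R) : set (X -> R) :=
  [set f | forall x y, f y - f x <= d x y].

Definition Lip1 (R : realType) (X : Type) (d : X -> X -> R) : set (X -> R) :=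
  [set f | forall x y, `|f y - f x| <= d x y].

Definition Gamma (R : realType) (z : R) : R :=
  \int[lebesgue_measure]_(t in `]0, +oo[) (t `^ (z - 1) * expR (- t)).

(* Lebesgue measure on R^n as an iterated product measure. *)
Fixpoint lebesgue_tuple (R : realType) (n : nat) :
    set (n.-tuple (measurableTypeR R)) -> \bar R :=
  match n with
  | 0%N => dirac [tuple]
  | m.+1 => pushforward (lebesgue_measure \x @lebesgue_tuple R m)%E
              (fun p : measurableTypeR R * m.-tuple (measurableTypeR R) =>
                 [tuple of p.1 :: p.2])
  end.

Fact lebesgue_tuple_sigma_finite_measure (R : realType) (n : nat) :
  exists m : {sigma_finite_measure set (n.-tuple (measurableTypeR R)) -> \bar R},
    m = @lebesgue_tuple R n :> (set _ -> _).
Proof.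
elim: n => [|n [m mE]].
  by exists (dirac [tuple] : {sigma_finite_measure set _ -> \bar R}).
pose f (p : measurableTypeR R * n.-tuple (measurableTypeR R)) : n.+1.-tuple (measurableTypeR R) :=
   [tuple of p.1 :: p.2].
have mf : measurable_fun setT f.
  exact: (@measurable_cons _ _ _ (measurableTypeR R) fst n snd).
pose mu : {measure set (n.+1.-tuple (measurableTypeR R)) -> \bar R} := measure_function_pushforward__canonical__measure_function_Measure (lebesgue_measure \x m)%E mf.
have sf : sigma_finite setT mu.
  have [F FT Ffin] : sigma_finite setT (@lebesgue_measure R \x m)%E.
    have /sigma_finiteP[F [TF ndF Foo]] := sigma_finiteT (@lebesgue_measure R : {sigma_finite_measure set _ -> \bar R}).
    have /sigma_finiteP[G [TG ndG Goo]] := sigma_finiteT m.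
    exists (fun n => F n `*` G n).
     rewrite -setXTT TF TG predeqE => -[x y]; split.
        move=> [/= [k1 _ Fnx] [k _ Gky]]; exists (maxn k1 k) => //; split.
        - by move: x Fnx; exact/subsetPset/ndF/leq_maxl.
        - by move: y Gky; exact/subsetPset/ndG/leq_maxr.
      by move=> [k1 _ []/= ? ?]; split; exists k1.
    move=> k; have [? ?] := Foo k; have [? ?] := Goo k.
    split; first exact: measurableX.
    by rewrite product_measure1E// lte_mul_pinfty// ge0_fin_numE.
  pose g (t : n.+1.-tuple (measurableTypeR R)) := (thead t, [tuple of behead t] : n.-tuple (measurableTypeR R)).
  have mg : measurable_fun setT g.
    apply/measurable_fun_pairP; split; first exact: measurable_tnth.
    exact: measurable_behead.
  have fg : cancel f g by case => a t; rewrite /g/f /=; congr (_, _); apply/val_inj.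
  exists (fun k => g @^-1` (F k)).
    by rewrite -preimage_bigcup -FT preimage_setT.
  move=> k; have [mFk ?] := Ffin k; split.
    by rewrite -[X in measurable X]setTI; apply: mg.
  rewrite /mu /= /pushforward -comp_preimage (_ : g \o f = id) //.
  by apply/funext => p; exact: fg.
pose mu' : {sigma_finite_measure set _ -> \bar R} := HB.pack (mu : set _ -> _) (Measure.on mu) (Measure_isSigmaFinite.Build _ _ _ mu sf).
by exists mu'; rewrite /mu' /mu /= mE.
Qed.

Section lebesgue_tuple_measure.
Variables (R : realType) (n : nat).
Local Notation mu := (@lebesgue_tuple R n).

Let mu0 : mu set0 = 0%E.
Proof. by have [m <-] := lebesgue_tuple_sigma_finite_measure R n. Qed.

Let mu_ge0 A : (0 <= mu A)%E.
Proof. by have [m <-] := lebesgue_tuple_sigma_finite_measure R n. Qed.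

Let mu_sigma_additive : semi_sigma_additive mu.
Proof.
have [m <-] := lebesgue_tuple_sigma_finite_measure R n.
exact: measure_semi_sigma_additive.
Qed.

HB.instance Definition _ :=
  isMeasure.Build _ _ _ mu mu0 mu_ge0 mu_sigma_additive.

Let mu_sigma_finite : sigma_finite setT mu.
Proof.
have [m <-] := lebesgue_tuple_sigma_finite_measure R n.
exact: sigma_finiteT.
Qed.

HB.instance Definition _ :=
  Measure_isSigmaFinite.Build _ _ _ mu mu_sigma_finite.

End lebesgue_tuple_measure.

Definition mu_ball (R : realType) (n : nat) (b : R) (A : set (unit_ball R n)) :
    \bar R :=
  let row_of (t : n.-tuple (measurableTypeR R)) : 'rV[R]_n := \row_i tnth t i in
  (\int[@lebesgue_tuple R n]_(t in row_of @^-1` (val @` A))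
     (Gamma (n%:R / 2 + b) / (pi `^ (n%:R / 2) * Gamma b)
       * (1 - enorm (row_of t) ^+ 2) `^ (b - 1))%:E)%E.

(* Main.v *)
From HB Require Import structures.
Require Import Defs.
From mathcomp Require Import all_boot all_order all_algebra.
From mathcomp Require Import all_classical all_reals all_analysis.
From mathcomp Require Import ring lra measurable_realfun.
Import Order.TTheory GRing.Theory Num.Theory.
Import numFieldNormedType.Exports.
Set Implicit Arguments.
Unset Strict Implicit.
Unset Printing Implicit Defensive.
Local Open Scope classical_set_scope.
Local Open Scope ring_scope.

(** The Funk norm is the Klein norm plus an exact form: by definition
    [funk_norm x v = klein_norm x v + <x, v> / (1 - |x|^2)], and the last term is
    the differential of [phi] at [x].  Along a piecewise C1 curve from [x] to [y]
    the exact form integrates to [phi y - phi x], so the lengths of curves for the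
    two norms differ by a constant that depends on the end points only
    ([lengths_funk]); taking infima gives the formula for the Funk distance.  The
    Klein norm is even, so reversing curves makes the Klein distance symmetric
    ([curve_dist_sym]); the maximum of the two Funk distances and the description
    of forward 1-Lipschitz functions follow by algebra.  The dual norm of the
    differential is a Cauchy-Schwarz computation ([dphi_le]).

    The symmetrized distance is compared with the Euclidean one.  It dominates
    [|y - x|], because the Klein norm does and a linear function with unit
    gradient is then a calibration ([enorm_le_klein_dist]); conversely segments
    show that it is small near each point ([sym_dist_near]).  So both induce the
    same topology, which gives separability.  The term [|phi y - phi x|] keeps
    Cauchy filters away from the sphere, which gives completeness.

    For the measure, the density is positive on the ball and every nonempty open
    set contains a box, hence the full support.  The total mass is computed by
    integrating out one coordinate at a time: with
    [I n b = \int_(|x| < 1) (1 - |x|^2)^(b-1) dx], a one-dimensional scaling gives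
    [I (n+1) b = I n (b + 1/2) * I 1 b] ([ball_integral_cons]), and Tonelli's
    theorem applied to [exp (- s^2 - t) t^(b-1)] together with the Gaussian
    integral gives [sqrt pi * Gamma b = Gamma (b + 1/2) * I 1 b]
    ([gauss_eGamma]). *)

(** * Euclidean geometry of row vectors *)

Section euclidean.
Variables (R : realType) (n : nat).
Implicit Types (x y z v : 'rV[R]_n) (k : R).

Lemma dotC x y : dot x y = dot y x.
Proof. by apply: eq_bigr => i _; rewrite mulrC. Qed.

Lemma dotDl x y z : dot (x + y) z = dot x z + dot y z.
Proof. by rewrite -big_split; apply: eq_bigr => i _; rewrite mxE mulrDl. Qed.

Lemma dotZl k x y : dot (k *: x) y = k * dot x y.
Proof. by rewrite /dot mulr_sumr; apply: eq_bigr => i _; rewrite mxE mulrA. Qed.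

Lemma dotDr x y z : dot z (x + y) = dot z x + dot z y.
Proof. by rewrite dotC dotDl !(dotC z). Qed.

Lemma dotZr k x y : dot x (k *: y) = k * dot x y.
Proof. by rewrite dotC dotZl dotC. Qed.

Lemma dotNr x y : dot x (- y) = - dot x y.
Proof. by rewrite -scaleN1r dotZr mulN1r. Qed.

Lemma dotNl x y : dot (- x) y = - dot x y.
Proof. by rewrite dotC dotNr dotC. Qed.

Lemma dot_ge0 x : 0 <= dot x x.
Proof. by apply: sumr_ge0 => i _; rewrite -expr2 sqr_ge0. Qed.

Lemma dot_eq0 x : dot x x = 0 -> x = 0.
Proof.
move=> /eqP; rewrite psumr_eq0; last by move=> i _; rewrite -expr2 sqr_ge0.
move=> /allP h; apply/rowP => i; rewrite mxE; apply/eqP.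
by rewrite -sqrf_eq0 expr2; apply: (implyP (h _ _)) => //; rewrite mem_index_enum.
Qed.

Lemma enorm_ge0 x : 0 <= enorm x.
Proof. exact: sqrtr_ge0. Qed.

Lemma enorm_sqr x : enorm x ^+ 2 = dot x x.
Proof. by rewrite sqr_sqrtr// dot_ge0. Qed.

Lemma enorm_eq0 x : enorm x = 0 -> x = 0.
Proof. by move=> h; apply: dot_eq0; rewrite -enorm_sqr h expr0n. Qed.

Lemma enorm0 : enorm (0 : 'rV[R]_n) = 0.
Proof.
by rewrite /enorm -(scale0r (0 : 'rV[R]_n)) dotZl mul0r sqrtr0.
Qed.

Lemma enormZ k x : enorm (k *: x) = `|k| * enorm x.
Proof.
by rewrite /enorm dotZl dotZr mulrA -expr2 sqrtrM ?sqr_ge0// sqrtr_sqr.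
Qed.

Lemma enormN x : enorm (- x) = enorm x.
Proof. by rewrite -scaleN1r enormZ normrN1 mul1r. Qed.

Lemma enormB x y : enorm (x - y) = enorm (y - x).
Proof. by rewrite -enormN opprB. Qed.

(** The nonnegative quadratic form [|b x - a y|^2], with [a = <x, y>] and
    [b = |y|^2], is [b] times the difference of the two sides. *)
Lemma cauchy_schwarz_sqr x y : dot x y ^+ 2 <= dot x x * dot y y.
Proof.
have [y0|y0] := eqVneq (dot y y) 0.
  rewrite (dot_eq0 y0) -(scale0r (0 : 'rV[R]_n)) dotZr dotZl.
  by rewrite !mul0r mulr0 expr0n.
have yp : 0 < dot y y by rewrite lt_neqAle eq_sym y0 dot_ge0.
have := dot_ge0 (dot y y *: x - dot x y *: y).
rewrite dotDl !dotDr !dotNl !dotNr !dotZl !dotZr (dotC y x) => h.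
rewrite -subr_ge0 -(pmulr_rge0 _ yp).
apply: le_trans h _; rewrite le_eqVlt; apply/orP; left; apply/eqP; ring.
Qed.

Lemma cauchy_schwarz x y : `|dot x y| <= enorm x * enorm y.
Proof.
rewrite -ler_sqr ?nnegrE ?mulr_ge0 ?enorm_ge0 ?normr_ge0//.
by rewrite real_normK ?num_real// exprMn !enorm_sqr cauchy_schwarz_sqr.
Qed.

Lemma enormD x y : enorm (x + y) <= enorm x + enorm y.
Proof.
rewrite -ler_sqr ?nnegrE ?addr_ge0 ?enorm_ge0//.
rewrite sqrrD !enorm_sqr dotDl !dotDr (dotC y x).
have := le_trans (ler_norm _) (cauchy_schwarz x y).
set e := enorm x * enorm y; rewrite -mulr_natl => h; lra.
Qed.

Lemma coord_le_enorm x i : `|x ord0 i| <= enorm x.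
Proof.
rewrite -sqrtr_sqr ler_sqrt ?dot_ge0// /dot (bigD1 i)//= -expr2 lerDl.
by apply: sumr_ge0 => j _; rewrite -expr2 sqr_ge0.
Qed.

Lemma mxnorm_le_enorm x : `|x| <= enorm x.
Proof.
rewrite [leLHS]/Num.norm/= mx_normrE; apply: bigmax_le; first exact: enorm_ge0.
by move=> [i j] _ /=; rewrite (ord1 i) coord_le_enorm.
Qed.

Lemma continuous_dot (T : topologicalType) (f g : T -> 'rV[R]_n) (t : T) :
  {for t, continuous f} -> {for t, continuous g} ->
  {for t, continuous (fun s => dot (f s) (g s))}.
Proof.
move=> cf cg; rewrite /dot; elim: (index_enum _) => [|i r ih].
  have -> : (fun s => \sum_(i <- [::]) f s ord0 i * g s ord0 i) = cst 0.
    by apply/funext => s; rewrite big_nil.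
  exact: cvg_cst.
have -> : (fun s => \sum_(j <- i :: r) f s ord0 j * g s ord0 j) =
    (fun s => f s ord0 i * g s ord0 i + \sum_(j <- r) f s ord0 j * g s ord0 j).
  by apply/funext => s; rewrite big_cons.
apply: cvgD ih; apply: cvgM.
  by apply: (@continuous_comp _ _ _ f (fun M : 'rV[R]_n => M ord0 i));
    [exact: cf | exact: coord_continuous].
by apply: (@continuous_comp _ _ _ g (fun M : 'rV[R]_n => M ord0 i));
    [exact: cg | exact: coord_continuous].
Qed.

Lemma continuous_enorm (T : topologicalType) (f : T -> 'rV[R]_n) (t : T) :
  {for t, continuous f} -> {for t, continuous (fun s => enorm (f s))}.
Proof.
move=> cf; apply: (@continuous_comp _ _ _ (fun s => dot (f s) (f s)) Num.sqrt).
  exact: continuous_dot.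
exact: sqrt_continuous.
Qed.

Lemma open_unit_ball : open [set x : 'rV[R]_n | enorm x < 1].
Proof.
apply: (@open_comp _ _ (@enorm R n) [set r | r < 1]); last exact: open_lt.
by move=> x _; exact: continuous_enorm.
Qed.

Lemma enorm_near0 x (e : R) : 0 < e -> \forall y \near x, enorm (y - x) < e.
Proof.
move=> e0; have := @continuous_enorm _ (fun y => y - x) x.
have cB : {for x, continuous (fun y : 'rV[R]_n => y - x)}.
  by apply: continuousB; [move=> ? ?|exact: cst_continuous].
move=> /(_ cB) /cvgr_lt; apply.
by rewrite subrr enorm0.
Qed.

End euclidean.

(** * The Klein and Funk norms and the differential of phi *)

Section klein_funk.
Variables (R : realType) (n : nat).
Implicit Types (x y z v : 'rV[R]_n) (k : R).

Definition defect x : R := 1 - enorm x ^+ 2.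

Lemma defect_gt0 x : enorm x < 1 -> 0 < defect x.
Proof. by move=> h; rewrite subr_gt0 expr_lt1// enorm_ge0. Qed.

Lemma defect_le1 x : defect x <= 1.
Proof. by rewrite /defect gerBl sqr_ge0. Qed.

(** The differential of [phi] at [x], see [is_diff_phi]. *)
Definition dphi x v : R := dot x v / defect x.

Lemma funk_normE x v : funk_norm x v = klein_norm x v + dphi x v.
Proof. by rewrite /funk_norm mulrDl. Qed.

Lemma klein_norm_ge0 x v : enorm x < 1 -> 0 <= klein_norm x v.
Proof. by move=> /defect_gt0/ltW h; rewrite divr_ge0// sqrtr_ge0. Qed.

Lemma klein_normN x v : klein_norm x (- v) = klein_norm x v.
Proof. by rewrite /klein_norm enormN dotNr sqrrN. Qed.

Lemma klein_normZ k x v : 0 <= k -> klein_norm x (k *: v) = k * klein_norm x v.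
Proof.
move=> k0; rewrite /klein_norm enormZ dotZr exprMn real_normK ?num_real// exprMn.
by rewrite mulrCA -mulrDr sqrtrM ?sqr_ge0// sqrtr_sqr ger0_norm// -mulrA.
Qed.

(** With [w = 1 - |x|^2], the difference of the squares of the two sides is
    [w (|x|^2 |v|^2 - <x, v>^2)] up to the positive factor [w^-2], so this is
    Cauchy-Schwarz with the sharp constant. *)
Lemma dphi_le x v : enorm x < 1 -> `|dphi x v| <= enorm x * klein_norm x v.
Proof.
move=> x1; have w0 := defect_gt0 x1.
rewrite /dphi /klein_norm normrM (gtr0_norm (x := _^-1)) ?invr_gt0// mulrA.
rewrite ler_pM2r ?invr_gt0//.
have h := cauchy_schwarz_sqr x v.
have w1 : 0 <= 1 - enorm x ^+ 2 := ltW w0.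
rewrite -ler_sqr ?nnegrE ?mulr_ge0 ?enorm_ge0 ?sqrtr_ge0 ?normr_ge0//.
have s0 : 0 <= (1 - enorm x ^+ 2) * enorm v ^+ 2 + dot x v ^+ 2.
  by apply: addr_ge0; [apply: mulr_ge0|]; rewrite ?sqr_ge0.
rewrite real_normK ?num_real// exprMn (sqr_sqrtr s0).
rewrite -subr_ge0.
have -> : enorm x ^+ 2 * ((1 - enorm x ^+ 2) * enorm v ^+ 2 + dot x v ^+ 2) -
    dot x v ^+ 2 =
   (1 - enorm x ^+ 2) * (dot x x * dot v v - dot x v ^+ 2).
  rewrite -!enorm_sqr; ring.
by rewrite mulr_ge0// subr_ge0.
Qed.

Lemma dphi_le_klein x v : enorm x < 1 -> `|dphi x v| <= klein_norm x v.
Proof.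
move=> x1; apply: (le_trans (dphi_le _ x1)).
by rewrite ler_piMl ?klein_norm_ge0// ltW.
Qed.

Lemma funk_norm_ge0 x v : enorm x < 1 -> 0 <= funk_norm x v.
Proof.
move=> x1; have := dphi_le_klein v x1.
by rewrite funk_normE ler_norml => /andP[h _]; rewrite -lerBlDl sub0r.
Qed.

Lemma enorm_le_klein x v : enorm x < 1 -> enorm v <= klein_norm x v.
Proof.
move=> x1; have w0 := defect_gt0 x1; rewrite /klein_norm ler_pdivlMr//.
have w1 : 0 <= 1 - enorm x ^+ 2 := ltW w0.
rewrite -ler_sqr ?nnegrE ?mulr_ge0 ?enorm_ge0 ?sqrtr_ge0//.
have s0 : 0 <= (1 - enorm x ^+ 2) * enorm v ^+ 2 + dot x v ^+ 2.
  by apply: addr_ge0; [apply: mulr_ge0|]; rewrite ?sqr_ge0.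
rewrite (sqr_sqrtr s0).
rewrite -[leLHS]addr0 lerD ?sqr_ge0// exprMn mulrC ler_wpM2r ?sqr_ge0//.
by rewrite expr2 ler_piMl ?defect_le1// ltW.
Qed.

Lemma klein_le_enorm x v : enorm x < 1 -> klein_norm x v <= enorm v / defect x.
Proof.
move=> x1; have w0 := defect_gt0 x1; rewrite /klein_norm ler_pM2r ?invr_gt0//.
rewrite -[leRHS]ger0_norm ?enorm_ge0// -sqrtr_sqr ler_sqrt ?sqr_ge0//.
have := cauchy_schwarz_sqr x v; rewrite -!enorm_sqr => h.
by rewrite mulrBl mul1r -addrA gerDl addrC subr_le0.
Qed.

Lemma continuous_defect (T : topologicalType) (f : T -> 'rV[R]_n) (t : T) :
  {for t, continuous f} -> {for t, continuous (fun s => defect (f s))}.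
Proof.
move=> cf; apply: cvgB; first exact: cvg_cst.
by apply: cvgM; apply: continuous_enorm.
Qed.

(** Joint continuity is tested on arbitrary continuous arguments, so that it
    applies verbatim to the subspace topology of a closed interval, where a curve
    and the extension of its derivative are continuous. *)
Definition ball_continuous (N : 'rV[R]_n -> 'rV[R]_n -> R) :=
  forall (T : topologicalType) (f g : T -> 'rV[R]_n) (t : T),
    enorm (f t) < 1 -> {for t, continuous f} -> {for t, continuous g} ->
    {for t, continuous (fun s => N (f s) (g s))}.

Lemma continuous_defectV (T : topologicalType) (f : T -> 'rV[R]_n) (t : T) :
  enorm (f t) < 1 -> {for t, continuous f} ->
  {for t, continuous (fun s => (defect (f s))^-1)}.
Proof.
move=> f1 cf; apply: (@cvgV _ _ _ _ (fun s => defect (f s))).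
  by rewrite gt_eqF// defect_gt0.
exact: continuous_defect.
Qed.

Lemma ball_continuous_dphi : ball_continuous dphi.
Proof.
move=> T f g t f1 cf cg; apply: cvgM; first exact: continuous_dot.
exact: continuous_defectV.
Qed.

Lemma ball_continuous_klein : ball_continuous (@klein_norm R n).
Proof.
move=> T f g t f1 cf cg; apply: cvgM; last exact: continuous_defectV.
apply: (@continuous_comp _ _ _ (fun s => defect (f s) * enorm (g s) ^+ 2 +
  dot (f s) (g s) ^+ 2) Num.sqrt); last exact: sqrt_continuous.
apply: cvgD; apply: cvgM.
- exact: continuous_defect.
- by apply: cvgM; apply: continuous_enorm.
- exact: continuous_dot.
- exact: continuous_dot.
Qed.

Lemma ball_continuous_funk : ball_continuous (@funk_norm R n).
Proof.
move=> T f g t f1 cf cg.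
rewrite (_ : (fun _ => _) =
  (fun s => klein_norm (f s) (g s) + dphi (f s) (g s))); last first.
  by apply/funext => s; rewrite funk_normE.
by apply: cvgD; [exact: ball_continuous_klein|exact: ball_continuous_dphi].
Qed.

Lemma is_diff_sum_seq (I : Type) (r : seq I) (f df : I -> 'rV[R]_n -> R) x :
  (forall i, is_diff x (f i) (df i)) ->
  is_diff x (fun y => \sum_(i <- r) f i y) (fun v => \sum_(i <- r) df i v).
Proof.
move=> h; elim: r => [|i r ih].
  have -> : (fun y => \sum_(i <- [::]) f i y) = cst 0.
    by apply/funext => y; rewrite big_nil.
  have -> : (fun y => \sum_(i <- [::]) df i y) = 0.
    by apply/funext => y; rewrite big_nil.
  exact: is_diff_cst.
have -> : (fun y => \sum_(i <- i :: r) f i y) =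
    f i + (fun y => \sum_(i <- r) f i y).
  by apply/funext => y; rewrite big_cons.
have -> : (fun y => \sum_(i <- i :: r) df i y) =
    df i + (fun y => \sum_(i <- r) df i y).
  by apply/funext => y; rewrite big_cons.
exact: is_diffD.
Qed.

Lemma is_diff_coord x i :
  is_diff x (fun y : 'rV[R]_n => y ord0 i) (fun v => v ord0 i).
Proof.
have @f : {linear 'rV[R]_n -> R}.
  by exists (fun N : 'rV[R]_n => N ord0 i); do 2![eexists]; do ?[constructor];
    rewrite ?mxE// => ? *; rewrite ?mxE//; move=> ?; rewrite !mxE.
have -> : (fun y : 'rV[R]_n => y ord0 i) = f by [].
have cf : continuous f by exact: coord_continuous.
apply: DiffDef; first exact: linear_differentiable.
by rewrite diff_lin.
Qed.

Lemma is_diff_dotr u x : is_diff x (dot u) (dot u).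
Proof.
apply: is_diff_sum_seq => i.
have -> : (fun y => u ord0 i * y ord0 i) =
  u ord0 i *: (fun y : 'rV[R]_n => y ord0 i) by [].
by have ? := is_diff_coord x i; exact: is_diffZ.
Qed.

Lemma is_diff_dot_sqr x :
  is_diff x (fun y => dot y y) (fun v => 2 * dot x v).
Proof.
rewrite (_ : (fun v => 2 * _) = fun v =>
    \sum_i (x ord0 i * v ord0 i + x ord0 i * v ord0 i)); last first.
  by apply/funext => v; rewrite big_split/= mulr_natl mulr2n.
apply: is_diff_sum_seq => i.
have ? := is_diff_coord x i.
exact: (is_diffM (f := fun y : 'rV[R]_n => y ord0 i)).
Qed.

(** [phi] is [- 1/2 ln] composed with [1 - <y, y>]; the chain rule produces the
    factor [2 <x, v>] that cancels the [1/2]. *)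
Lemma is_diff_phi x : enorm x < 1 -> is_diff x (@phi R n) (dphi x).
Proof.
move=> x1; have w0 := defect_gt0 x1.
pose h (w : R) := - (1 / 2 * ln w).
pose w (y : 'rV[R]_n) := 1 - dot y y.
have -> : @phi R n = h \o w.
  by apply/funext => y; rewrite /phi/= enorm_sqr.
have wx : w x = defect x by rewrite /w /defect enorm_sqr.
have dw : is_diff x w (fun v => - (2 * dot x v)).
  have ? := is_diff_dot_sqr x.
  have : is_diff x (cst 1 - (fun y : 'rV[R]_n => dot y y))
    (0 - (fun v => 2 * dot x v)) by exact: is_diffB.
  by move=> /is_diff_eq; apply; apply/funext => v; rewrite /= sub0r.
have dh : is_diff (w x) h (fun r : R => - (1 / 2 * (w x)^-1) * r).
  have dl : is_derive (w x) 1 h (- (1 / 2 * (w x)^-1)).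
    have ? : is_derive (w x) 1 (@ln R) (w x)^-1.
      by apply: is_derive1_ln; rewrite wx.
    exact: is_deriveN.
  have dd : differentiable h (w x) by apply/derivable1_diffP; apply: ex_derive.
  apply: DiffDef => //; apply/funext => r.
  have -> : 'd h (w x) r = r * 'd h (w x) 1.
    by rewrite -[r in LHS]mulr1 -[r * 1]/(r *: (1:R^o)) linearZ.
  by rewrite -derive1E' // derive1E derive_val mulrC.
have := @is_diff_comp _ _ _ _ w _ h _ x dw dh.
move=> /is_diff_eq; apply; apply/funext => v /=.
rewrite /dphi -wx; field.
by rewrite wx gt_eqF.
Qed.

Lemma differentiable_phi x : enorm x < 1 -> differentiable (@phi R n) x.
Proof. by move=> /is_diff_phi[]. Qed.

Lemma diff_phi x v : enorm x < 1 -> 'd (@phi R n) x v = dphi x v.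
Proof. by move=> /is_diff_phi[_ ->]. Qed.

Lemma dual_klein_dphi x : enorm x < 1 ->
  dual_norm (klein_norm x) (dphi x) = enorm x.
Proof.
move=> x1; have w0 := defect_gt0 x1; rewrite /dual_norm.
set S := [set _ | _ in _].
have S0 : S 0.
  exists 0; first by rewrite /= /klein_norm -(scale0r (0 : 'rV[R]_n)) enormZ dotZr
    normr0 !mul0r !expr0n/= mulr0 addr0 sqrtr0 mul0r.
  by rewrite /dphi -(scale0r (0 : 'rV[R]_n)) dotZr !mul0r normr0.
have ubS : ubound S (enorm x).
  move=> _ [v /= v1 <-]; apply: (le_trans (dphi_le v x1)).
  by rewrite ler_piMr ?enorm_ge0.
apply/eqP; rewrite eq_le; apply/andP; split.
  by apply: ge_sup => //; exists 0.
have [x0|x0] := eqVneq (enorm x) 0.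
  by rewrite {1}x0; apply: ub_le_sup => //; exists (enorm x).
have xp : 0 < enorm x by rewrite lt_neqAle eq_sym x0 enorm_ge0.
(* the supremum is attained in the radial direction *)
apply: ub_le_sup; first by exists (enorm x).
have kx : klein_norm x x = enorm x / defect x.
  rewrite /klein_norm -enorm_sqr -/(defect x).
  rewrite (_ : _ + _ = enorm x ^+ 2); last by rewrite /defect; ring.
  by rewrite sqrtr_sqr ger0_norm ?enorm_ge0.
exists ((defect x / enorm x) *: x) => /=.
  rewrite klein_normZ ?divr_ge0 ?enorm_ge0 ?(ltW w0)// kx.
  by rewrite mulrA mulfVK// divff ?gt_eqF.
rewrite /dphi dotZr -enorm_sqr ger0_norm; last first.
  by rewrite !mulr_ge0 ?invr_ge0 ?sqr_ge0 ?enorm_ge0 ?(ltW w0).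
by field; rewrite x0 gt_eqF.
Qed.

End klein_funk.

(** * Affine changes of variable *)

Section affine_change.
Variable R : realType.
Local Notation mu := (@lebesgue_measure R).

Definition affine_map (k c : R) (t : measurableTypeR R) : measurableTypeR R :=
  k * t + c.

Lemma measurable_affine k c : measurable_fun setT (affine_map k c).
Proof.
by apply: measurable_funD => //; apply: measurable_funM => //;
  exact: measurable_id.
Qed.

Lemma affine_preimage_itvoc (k c a b : R) : 0 < k ->
  affine_map k c @^-1` `]a, b] = `](a - c) / k, (b - c) / k]%classic.
Proof.
move=> k0; apply/seteqP; split => x /=; rewrite !in_itv/= /affine_map
  ltr_pdivrMr// ler_pdivlMr// ltrBlDr lerBrDr (mulrC k)//.
Qed.

(** Lebesgue measure is determined by its values on half-open intervals. *)
Lemma lebesgue_measure_affine (k c : R) (A : set R) : 0 < k -> measurable A ->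
  mu A = (k%:E * pushforward mu (affine_map k c) A)%E.
Proof.
move=> k0 mA.
pose nu : {measure set (measurableTypeR R) -> \bar R} :=
  mscale (NngNum (ltW k0))
    (measure_function_pushforward__canonical__measure_function_Measure
      mu (measurable_affine k c)).
rewrite (@lebesgue_measure_unique _ nu)// => _ [[a b] _ <-].
rewrite [RHS](_ : _ = (k%:E * mu (affine_map k c @^-1` `]a, b]))%E)//.
rewrite affine_preimage_itvoc//.
rewrite !lebesgue_measure_itv/= !lte_fin ltr_pM2r ?invr_gt0// ltrD2r.
case: ifP => _; last by rewrite mule0.
by rewrite -!EFinB -EFinM; congr EFin; field; rewrite gt_eqF.
Qed.

Lemma ge0_integral_affine (k c : R) (D : set R) (f : R -> \bar R) :
  0 < k -> measurable D -> measurable_fun D f ->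
  (forall x, D x -> (0 <= f x)%E) ->
  (\int[mu]_(x in D) f x =
   k%:E * \int[mu]_(x in [set x | D (k * x + c)%R]) f (k * x + c)%R)%E.
Proof.
move=> k0 mD mf f0.
pose nu : {measure set (measurableTypeR R) -> \bar R} :=
  (measure_function_pushforward__canonical__measure_function_Measure
      mu (measurable_affine k c)).
transitivity (\int[mscale (NngNum (ltW k0)) nu]_(x in D) f x)%E.
  apply: eq_measure_integral => A mA _.
  by rewrite [RHS]/= /mscale /= -lebesgue_measure_affine.
rewrite ge0_integral_mscale//=; congr (_ * _)%E.
rewrite (ge0_integral_pushforward (measurable_affine k c) mu mD mf)//.
by move=> y /set_mem/f0.
Qed.

Lemma ge0_integral_opp (D : set R) (f : R -> \bar R) :
  measurable D -> measurable_fun D f -> (forall x, D x -> (0 <= f x)%E) ->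
  (\int[mu]_(x in D) f x = \int[mu]_(x in [set x | D (- x)%R]) f (- x)%R)%E.
Proof.
move=> mD mf f0.
have mN : measurable_fun setT (-%R : measurableTypeR R -> measurableTypeR R).
  by [].
transitivity (\int[pushforward mu (-%R : _ -> measurableTypeR R)]_(x in D) f x)%E.
  by apply: eq_measure_integral => A mA _; exact/esym/lebesgue_measureN.
rewrite (ge0_integral_pushforward mN mu mD mf)//.
by move=> y /set_mem/f0.
Qed.

End affine_change.

(** * Continuity and integrals on adjacent intervals *)

Section within_tools.
Variable R : realType.
Local Notation mu := (@lebesgue_measure R).

Lemma within_continuous_precomp (V : topologicalType) (A B : set R)
    (f : R -> V) (g : R -> R) :
  continuous g -> (forall t, B t -> A (g t)) ->
  {within A, continuous f} -> {within B, continuous (f \o g)}.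
Proof.
move=> cg BA /subspace_continuousP cf; apply/subspace_continuousP => t Bt.
move=> U /(cf _ (BA _ Bt)) h.
have {}h : nbhs t [set s | A (g s) -> U (f (g s))] := cg t _ h.
suff : nbhs t [set s | B s -> U (f (g s))] by [].
by apply: filterS h => s /= h Bs; exact/h/BA.
Qed.

Lemma setIccU (a x b : R) : a <= x -> x <= b ->
  `[a, b]%classic = `[a, x] `|` `[x, b].
Proof.
move=> ax xb; apply/seteqP; split => t /=; rewrite !in_itv/=.
  by move=> /andP[at_ tb]; case: (leP t x) => tx; [left|right];
    rewrite ?at_ ?tx ?tb ?(ltW tx).
by move=> [/andP[at_ tx]|/andP[xt tb]]; rewrite ?at_ ?tb ?(le_trans tx)// ?(le_trans ax).
Qed.

Lemma setIccoo (a b : R) : a <= b ->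
  `[a, b]%classic = `]a, b[ `|` [set a] `|` [set b].
Proof.
move=> ab; apply/seteqP; split => t /=; rewrite !in_itv/=.
  move=> /andP[]; rewrite le_eqVlt => /orP[/eqP->|at_]; first by left; right.
  by rewrite le_eqVlt => /orP[/eqP->|tb]; [right|left; left; rewrite at_].
by move=> [[/andP[/ltW-> /ltW->]//|->]|->]; rewrite lexx ?ab.
Qed.

(** At a break point the derivative of a piecewise C1 curve is an arbitrary value,
    so integrands are controlled inside the pieces only and extended over the end
    points, which form a null set. *)
Lemma integrable_itvoo_cc (g : R -> R) (a b : R) :
  mu.-integrable `]a, b[ (EFin \o g) -> mu.-integrable `[a, b] (EFin \o g).
Proof.
have [ab|ba] := leP a b; last first.
  by move=> _; rewrite set_itv_ge ?bnd_simp -?ltNge//; exact: integrable_set0.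
move=> ig; pose N : set R := [set a] `|` [set b].
have mN : measurable N by apply: measurableU; exact: measurable_set1.
have mg : measurable_fun `[a, b] (EFin \o g).
  rewrite setIccoo//; apply/measurable_funU.
  - by apply: measurableU; [exact: measurable_itv|exact: measurable_set1].
  - exact: measurable_set1.
  split; last exact: measurable_fun_set1.
  apply/measurable_funU; [exact: measurable_itv|exact: measurable_set1|].
  split; last exact: measurable_fun_set1.
  exact: measurable_int ig.
have N0 : mu N = 0%E.
  by rewrite [LHS]measureU0//; exact: lebesgue_measure_set1.
have [_] := negligible_integrable (mu := mu) mN (measurable_itv `[a, b]) mg N0; apply.
apply: integrableS ig => //; first exact: measurableD.
move=> t [] /=; rewrite !in_itv/= => /andP[at_ tb] /not_orP[ta tb'].
by rewrite !lt_neqAle at_ tb !andbT eq_sym; apply/andP; split; apply/eqP.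
Qed.

Lemma integrable_itvcc_oo (g : R -> R) (a b : R) :
  mu.-integrable `[a, b] (EFin \o g) -> mu.-integrable `]a, b[ (EFin \o g).
Proof. by apply: integrableS => //; exact: subset_itv_oo_cc. Qed.

Lemma Rintegral_itvoo_cc (g : R -> R) (a b : R) :
  mu.-integrable `[a, b] (EFin \o g) ->
  \int[mu]_(t in `]a, b[) g t = \int[mu]_(t in `[a, b]) g t.
Proof.
move=> ig; rewrite Rintegral_itv_bndo_bndc; last exact: integrable_itvcc_oo.
rewrite Rintegral_itv_obnd_cbnd//; apply: integrableS ig => //.
exact: subset_itv_oc_cc.
Qed.

Lemma eq_oo_integrable (g h : R -> R) (a b : R) :
  {in `]a, b[, g =1 h} -> mu.-integrable `[a, b] (EFin \o h) ->
  mu.-integrable `[a, b] (EFin \o g).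
Proof.
move=> gh ih; apply: integrable_itvoo_cc.
apply: eq_integrable (integrable_itvcc_oo ih) => //.
by move=> t /set_mem /= tab; rewrite gh.
Qed.

Lemma eq_oo_Rintegral (g h : R -> R) (a b : R) :
  {in `]a, b[, g =1 h} -> mu.-integrable `[a, b] (EFin \o h) ->
  \int[mu]_(t in `[a, b]) g t = \int[mu]_(t in `[a, b]) h t.
Proof.
move=> gh ih; rewrite -Rintegral_itvoo_cc; last exact: eq_oo_integrable ih.
rewrite -Rintegral_itvoo_cc//; apply: eq_Rintegral => t /set_mem /= tab.
by rewrite gh.
Qed.

Lemma integrable_setU d (T : measurableType d)
    (m : {measure set T -> \bar R}) (A B : set T) (f : T -> \bar R) :
  measurable A -> measurable B ->
  m.-integrable A f -> m.-integrable B f -> m.-integrable (A `|` B) f.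
Proof.
move=> mA mB /integrableP[mfA fA] /integrableP[mfB fB]; apply/integrableP; split.
  exact/measurable_funU.
have -> : A `|` B = A `|` (B `\` A).
  by apply/seteqP; split => t; [case: (pselect (A t)); [left|move=> ? []; [|right]]
    |move=> [|[]]; [left|right]].
rewrite ge0_integral_setU//=; first last.
- by apply/disj_setPS => t [At []].
- apply/measurable_funU => //; first exact: measurableD.
  split; first exact: measurableT_comp.
  by apply: measurableT_comp => //; apply: measurable_funS mfB.
- exact: measurableD.
apply: lte_add_pinfty => //; apply: le_lt_trans fB.
apply: ge0_subset_integral => //; first exact: measurableD.
exact: measurableT_comp.
Qed.

Lemma integrable_itvcc_cat (g : R -> R) (a x b : R) : a <= x -> x <= b ->
  mu.-integrable `[a, x] (EFin \o g) -> mu.-integrable `[x, b] (EFin \o g) ->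
  mu.-integrable `[a, b] (EFin \o g).
Proof.
by move=> ax xb h1 h2; rewrite (setIccU ax xb); exact: integrable_setU.
Qed.

Lemma Rintegral_itvcc_cat (g : R -> R) (a x b : R) : a <= x -> x <= b ->
  mu.-integrable `[a, b] (EFin \o g) ->
  \int[mu]_(t in `[a, b]) g t =
  \int[mu]_(t in `[a, x]) g t + \int[mu]_(t in `[x, b]) g t.
Proof.
move=> ax xb ig.
have := @Rintegral_itvB R g (BLeft a) (BRight b) x ig.
rewrite !bnd_simp => /(_ ax xb) h.
rewrite -[X in _ + X]Rintegral_itv_obnd_cbnd -?h; last first.
  by apply: integrableS ig => //; apply: subset_itvr; rewrite bnd_simp.
by rewrite addrC subrK.
Qed.

End within_tools.

(** * Integrals along piecewise C1 curves *)

Section C1_curves.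
Variables (R : realType) (n : nat).
Local Notation mu := (@lebesgue_measure R).
Implicit Types (c : R -> 'rV[R]_n) (a b : R).

Lemma C1_on_eq c c' a b : {in `[a, b], c =1 c'} -> C1_on c a b -> C1_on c' a b.
Proof.
move=> cc' [cont der [dc cdc dcE]].
have nearcc' t : t \in `]a, b[ -> {near t, c =1 c'}.
  move=> tab; near=> s; apply: cc'; apply: subset_itv_oo_cc.
  by near: s; exact: near_in_itvoo.
split.
- by apply: subspace_eq_continuous cont => t /set_mem; exact: cc'.
- by move=> t tab; apply: near_eq_derivable (nearcc' t tab) (der t tab).
- exists dc => // t tab; rewrite -(dcE t tab) !derive1E.
  by apply/esym; apply: near_eq_derive; exact: nearcc'.
Unshelve. all: by end_near. Qed.

Lemma eq_oo_derive1 c c' a b :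
  {in `]a, b[, c =1 c'} -> {in `]a, b[, derive1 c =1 derive1 c'}.
Proof.
move=> cc' t tab; rewrite !derive1E; apply: near_eq_derive.
by near=> s; apply: cc'; near: s; exact: near_in_itvoo.
Unshelve. all: by end_near. Qed.

(** Both sides are the limit of the same difference quotient. *)
Lemma derive1_shift c m t : derive1 (fun s => c (s + m)) t = derive1 c (t + m).
Proof. by rewrite /derive1; under eq_fun do rewrite -addrA. Qed.

Lemma derivable_shift c m t : derivable c (t + m) 1 ->
  derivable (fun s => c (s + m)) t 1.
Proof.
move=> h; rewrite /derivable [X in cvg (X @ _)](_ : _ =
  (fun h : R => h^-1 *: ((c \o shift (t + m)) (h *: 1) - c (t + m))))//.
by apply/funext => k /=; rewrite addrA.
Qed.

Lemma C1_on_shift c m a b : C1_on c (a + m) (b + m) ->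
  C1_on (fun s => c (s + m)) a b.
Proof.
have sh t : t \in `[a, b] -> t + m \in `[a + m, b + m].
  by rewrite !in_itv/= !lerD2r.
have sho t : t \in `]a, b[ -> t + m \in `]a + m, b + m[.
  by rewrite !in_itv/= !ltrD2r.
have cm : continuous (fun t : R => t + m).
  by move=> t; apply: continuousD; [move=> ? ?|exact: cst_continuous].
move=> [cont der [dc cdc dcE]]; split.
- exact: within_continuous_precomp cont.
- by move=> t /sho/der; exact: derivable_shift.
- exists (fun s => dc (s + m)); first exact: within_continuous_precomp cdc.
  by move=> t tab; rewrite derive1_shift dcE//; exact: sho.
Qed.

Lemma is_derive_opp c t : derivable c (- t) 1 ->
  is_derive t 1 (fun s => c (- s)) (- derive1 c (- t)).
Proof.
move=> /derivable1_diffP dc.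
have dN : is_diff t (-%R : R -> R) (-%R : R -> R).
  by have := is_diffN (is_diff_id t).
have dcN : is_diff (- t) c ('d c (- t)) by exact: differentiableP.
have := @is_diff_comp _ _ _ _ (-%R : R -> R) (-%R) c _ t dN dcN.
move=> [dd ddE].
apply: DeriveDef; first exact/derivable1_diffP.
rewrite -derive1E derive1E'// ddE/= derive1E'//.
by rewrite linearN.
Qed.

Lemma C1_on_opp c a b : C1_on c a b -> C1_on (fun s => c (- s)) (- b) (- a).
Proof.
have sh t : t \in `[- b, - a] -> - t \in `[a, b].
  by rewrite !in_itv/= lerNl lerNr andbC.
have sho t : t \in `]- b, - a[ -> - t \in `]a, b[.
  by rewrite !in_itv/= ltrNl ltrNr andbC.
have cm : continuous (-%R : R -> R) by exact: opp_continuous.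
move=> [cont der [dc cdc dcE]]; split.
- exact: within_continuous_precomp cont.
- by move=> t /sho/der/is_derive_opp[].
- exists (fun s => - dc (- s)).
    have : {within `[- b, - a], continuous (dc \o -%R)}.
      exact: within_continuous_precomp cdc.
    by move=> h t; apply: continuousN; exact: h.
  move=> t tab; have /is_derive_opp[_] := der _ (sho _ tab).
  by rewrite -derive1E => ->; rewrite dcE//; exact: sho.
Qed.

(** Piecewise C1 curves, described by cutting off the first piece; induction on
    this predicate replaces the bookkeeping of subdivision points. *)
Inductive pwC1 c : R -> R -> Prop :=
| pwC1_nil a : pwC1 c a a
| pwC1_cons a x b : a < x -> C1_on c a x -> pwC1 c x b -> pwC1 c a b.

Lemma pwC1_le c a b : pwC1 c a b -> a <= b.
Proof. by elim=> // {}a x {}b ax _ _; exact/le_trans/ltW. Qed.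

Lemma pwC1_continuous c a b : pwC1 c a b -> {within `[a, b], continuous c}.
Proof.
elim=> {a b} [a|a x b ax [cont _ _] /pwC1_le xb ih].
  by rewrite set_itv1; exact: continuous_subspace1.
rewrite (setIccU (ltW ax) xb); apply: withinU_continuous => //;
  exact: itv_closed.
Qed.

Lemma piecewise_C1P c a b : piecewise_C1 c a b <-> pwC1 c a b.
Proof.
split=> [[_ [s]]|h].
  elim: s a => [|x s ih] a /= ps.
    by rewrite (itv_partition_nil ps) => _; exact: pwC1_nil.
  move=> h; case: (ps) => /= /andP[ax _] _.
  apply: (pwC1_cons ax (h 0%N erefl)).
  apply: ih; first exact: itv_partition_cons ps.
  by move=> i si; exact: (h i.+1).
split; first exact: pwC1_continuous.
elim: h => {a b} [a|a x b ax hc _ [s [ps ls] ih]].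
  by exists [::] => //; split => //=.
exists (x :: s); first by split => //=; rewrite ax.
by move=> [|i] //= si; exact: ih.
Qed.

Lemma pwC1_eq c c' a b : {in `[a, b], c =1 c'} -> pwC1 c a b -> pwC1 c' a b.
Proof.
move=> + h; elim: h => {a b} [a _|a x b ax hc h ih cc']; first exact: pwC1_nil.
have xb := pwC1_le h.
apply: (pwC1_cons ax).
  apply: C1_on_eq hc => t tax; apply: cc'; apply: subset_itvl tax.
  by rewrite bnd_simp.
apply: ih => t txb; apply: cc'; apply: subset_itvr txb.
by rewrite bnd_simp ltW.
Qed.

Lemma pwC1_cat c a x b : pwC1 c a x -> pwC1 c x b -> pwC1 c a b.
Proof. by elim=> // {}a y {}x ay hc h ih /ih; exact: pwC1_cons. Qed.

Lemma pwC1_shift c m a b : pwC1 c (a + m) (b + m) -> pwC1 (fun s => c (s + m)) a b.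
Proof.
suff h u v : pwC1 c u v -> pwC1 (fun s => c (s + m)) (u - m) (v - m).
  by move=> /h; rewrite !addrK.
elim=> {u v} [u|u x v ux hc _]; first exact: pwC1_nil.
apply: pwC1_cons; first by rewrite ltrD2r.
by apply: C1_on_shift; rewrite !subrK.
Qed.

Lemma pwC1_opp c a b : pwC1 c a b -> pwC1 (fun s => c (- s)) (- b) (- a).
Proof.
elim=> {a b} [a|a x b ax hc _ ih]; first exact: pwC1_nil.
apply: pwC1_cat ih _; apply: pwC1_cons (pwC1_nil _ _); first by rewrite ltrN2.
exact: C1_on_opp.
Qed.

Definition in_ball c a b := {in `[a, b], forall t, enorm (c t) < 1}.

Lemma in_ball_sub c a b a' b' : a <= a' -> b' <= b ->
  in_ball c a b -> in_ball c a' b'.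
Proof.
move=> aa' bb' h t; rewrite in_itv/= => /andP[a't tb']; apply: h.
by rewrite in_itv/= (le_trans aa' a't) (le_trans tb' bb').
Qed.

Definition speed (N : 'rV[R]_n -> 'rV[R]_n -> R) c (t : R) : R := N (c t) (derive1 c t).

Lemma within_speed N c dc a b : ball_continuous N -> in_ball c a b ->
  {within `[a, b], continuous c} -> {within `[a, b], continuous dc} ->
  {within `[a, b], continuous (fun t => N (c t) (dc t))}.
Proof.
move=> cN hb cc cdc; rewrite continuous_subspace_in => t /set_mem tab.
by apply: (cN (subspace `[a, b])); [exact: hb|exact: cc|exact: cdc].
Qed.

Lemma speed_integrable_C1 N c a b : ball_continuous N -> in_ball c a b ->
  C1_on c a b -> mu.-integrable `[a, b] (EFin \o speed N c).
Proof.
move=> cN hb [cont der [dc cdc dcE]].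
apply: (@eq_oo_integrable _ _ (fun t => N (c t) (dc t))).
  by move=> t tab; rewrite /speed dcE.
apply: continuous_compact_integrable; first exact: segment_compact.
exact: within_speed.
Qed.

Lemma speed_integrable N c a b : ball_continuous N -> in_ball c a b ->
  pwC1 c a b -> mu.-integrable `[a, b] (EFin \o speed N c).
Proof.
move=> cN + h; elim: h => {a b} [a _|a x b ax hc h ih hb].
  rewrite set_itv1; apply: null_set_integrable => //.
    exact: measurable_fun_set1.
  exact: lebesgue_measure_set1.
have xb := pwC1_le h.
apply: (integrable_itvcc_cat (ltW ax) xb).
  by apply: speed_integrable_C1 => //; exact: in_ball_sub hb.
by apply: ih; apply: in_ball_sub hb => //; exact: ltW.
Qed.

Lemma Rintegral_speed_cons N c a x b : ball_continuous N -> in_ball c a b ->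
  a < x -> C1_on c a x -> pwC1 c x b ->
  \int[mu]_(t in `[a, b]) speed N c t =
  \int[mu]_(t in `[a, x]) speed N c t + \int[mu]_(t in `[x, b]) speed N c t.
Proof.
move=> cN hb ax hc h; have xb := pwC1_le h; apply: Rintegral_itvcc_cat => //.
  exact: ltW.
by apply: speed_integrable => //; exact: pwC1_cons h.
Qed.

(** On each piece this is the fundamental theorem of calculus for [f \o c]; the
    boundary terms telescope over the pieces. *)
Lemma Rintegral_diff (f : 'rV[R]_n -> R) (D : 'rV[R]_n -> 'rV[R]_n -> R) c a b :
  ball_continuous D -> (forall x, enorm x < 1 -> is_diff x f (D x)) ->
  in_ball c a b -> pwC1 c a b ->
  \int[mu]_(t in `[a, b]) speed D c t = f (c b) - f (c a).
Proof.
move=> cD dfD + h; elim: h => {a b} [a _|a x b ax hc h ih hb].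
  by rewrite set_itv1 Rintegral_set1 subrr.
have xb := pwC1_le h.
rewrite (Rintegral_speed_cons cD hb ax hc h) ih; last first.
  by apply: in_ball_sub hb => //; exact: ltW.
have hbx : in_ball c a x by exact: in_ball_sub hb.
suff -> : \int[mu]_(t in `[a, x]) speed D c t = f (c x) - f (c a) by ring.
case: hc => cont der [dc cdc dcE].
rewrite (@eq_oo_Rintegral _ _ (fun t => D (c t) (dc t))); first last.
- apply: continuous_compact_integrable; first exact: segment_compact.
  exact: within_speed.
- by move=> t tab; rewrite /speed dcE.
rewrite /Rintegral (continuous_FTC2 (F := f \o c) ax)//.
- exact: within_speed.
- have dfc t : t \in `]a, x[ -> derivable (f \o c) t 1.
    move=> tax; apply/derivable1_diffP; apply: differentiable_comp.
      exact/derivable1_diffP/der.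
    have := dfD (c t); case => //; apply: hbx; exact: subset_itv_oo_cc.
  have : {within `[a, x], continuous (f \o c)}.
    apply: within_continuous_comp => // y /set_mem [t tax <-].
    have ct1 : enorm (c t) < 1 by exact: hbx.
    by case: (dfD (c t) ct1) => + _; exact: differentiable_continuous.
  by move=> /(continuous_within_itvP _ ax)[_ ? ?]; split.
- move=> t tax.
  have ct1 : enorm (c t) < 1 by apply: hbx; exact: subset_itv_oo_cc.
  have [dft dftE] := dfD (c t) ct1.
  have dct : differentiable c t by exact/derivable1_diffP/der.
  rewrite derive1E'; last exact: differentiable_comp.
  by rewrite diff_comp//= dftE -derive1E'// dcE.
Qed.

Lemma Rintegral_speed_shift N c m a b : ball_continuous N ->
  (forall x v, enorm x < 1 -> 0 <= N x v) ->
  in_ball c (a + m) (b + m) -> pwC1 c (a + m) (b + m) ->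
  \int[mu]_(t in `[a, b]) speed N (fun s => c (s + m)) t =
  \int[mu]_(t in `[a + m, b + m]) speed N c t.
Proof.
move=> cN N0 hb h; rewrite [RHS]/Rintegral.
rewrite (@ge0_integral_affine _ 1 m)//; first last.
- by move=> t tab; rewrite lee_fin; apply: N0; exact: hb.
- exact: measurable_int (speed_integrable cN hb h).
rewrite mul1e.
have -> : [set x | `[a + m, b + m]%classic (1 * x + m)] = `[a, b]%classic.
  by apply/seteqP; split => t /=; rewrite mul1r !in_itv/= !lerD2r.
transitivity (\int[mu]_(t in `[a, b]) speed N c (1 * t + m)); last by [].
by apply: eq_Rintegral => t _; rewrite mul1r /speed derive1_shift.
Qed.

(** The derivative of the reversed curve is known inside the pieces only, hence the
    induction over pieces instead of one global change of variable. *)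
Lemma Rintegral_speed_opp N c a b : ball_continuous N ->
  (forall x v, enorm x < 1 -> 0 <= N x v) ->
  (forall x v, N x (- v) = N x v) ->
  in_ball c a b -> pwC1 c a b ->
  \int[mu]_(t in `[- b, - a]) speed N (fun s => c (- s)) t =
  \int[mu]_(t in `[a, b]) speed N c t.
Proof.
move=> cN N0 NN + h; elim: h => {a b} [a _|a x b ax hc h ih hb].
  by rewrite !set_itv1 !Rintegral_set1.
have xb := pwC1_le h.
have hbx : in_ball c a x by exact: in_ball_sub hb.
have hbN : in_ball (fun s => c (- s)) (- b) (- a).
  by move=> t tab; apply: hb; move: tab; rewrite !in_itv/= lerNl lerNr andbC.
have iN : mu.-integrable `[- b, - a] (EFin \o speed N (fun s => c (- s))).
  exact: (speed_integrable cN hbN (pwC1_opp (pwC1_cons ax hc h))).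
have hxb : in_ball c x b := in_ball_sub (ltW ax) (lexx b) hb.
have xbN : - b <= - x by rewrite lerN2.
have axN : - x <= - a by rewrite lerN2 ltW.
have ic := speed_integrable_C1 cN hbx hc.
have ixN : mu.-integrable `[- x, - a] (EFin \o speed N (fun s => c (- s))).
  exact: (speed_integrable_C1 cN (in_ball_sub xbN (lexx _) hbN) (C1_on_opp hc)).
have piece : \int[mu]_(t in `[- x, - a]) speed N (fun s => c (- s)) t =
    \int[mu]_(t in `[a, x]) speed N c t.
  transitivity (\int[mu]_(t in `[- x, - a]) speed N c (- t)).
    apply/esym; apply: eq_oo_Rintegral ixN => t txa; rewrite /speed.
    case: hc => _ der _; have tax : - t \in `]a, x[.
      by move: txa; rewrite !in_itv/= ltrNl ltrNr andbC.
    by have /is_derive_opp[_] := der _ tax; rewrite -derive1E => ->; rewrite NN.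
  have pos t : `[a, x]%classic t -> (0 <= (EFin \o speed N c) t)%E.
    by move=> tab; rewrite lee_fin; apply: N0; exact: hbx.
  have E := ge0_integral_opp (measurable_itv `[a, x]) (measurable_int _ ic) pos.
  have set_opp : [set t | `[a, x]%classic (- t)] = `[- x, - a]%classic.
    by apply/seteqP; split => t /=; rewrite !in_itv/= lerNl lerNr andbC.
  rewrite set_opp in E.
  exact: (congr1 fine (esym E)).
apply: (etrans (Rintegral_itvcc_cat xbN axN iN)).
apply/esym; apply: (etrans (Rintegral_speed_cons cN hb ax hc h)).
by rewrite -piece -(ih hxb) addrC.
Qed.

End C1_curves.

(** * Distances defined by lengths of curves *)

Section curve_distances.
Variables (R : realType) (n : nat).
Local Notation mu := (@lebesgue_measure R).
Local Notation ball := (unit_ball R n).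
Implicit Types (N : 'rV[R]_n -> 'rV[R]_n -> R) (x y z : ball).

Definition lengths N x y : set R :=
  [set l : R | exists (a b : R) (c : R -> 'rV[R]_n),
    [/\ a < b, pwC1 c a b, in_ball c a b, c a = val x /\ c b = val y &
        l = \int[mu]_(t in `[a, b]) speed N c t]].

Lemma curve_distE N x y : curve_dist N x y = inf (lengths N x y).
Proof.
congr inf; apply/seteqP; split => l [a [b [c [ab h hb e ->]]]];
  by exists a, b, c; split => //; exact/piecewise_C1P.
Qed.

(** The closed Euclidean ball of radius [r] is convex. *)
Lemma segment_curve (x y : 'rV[R]_n) (r : R) : enorm x <= r -> enorm y <= r ->
  exists c : R -> 'rV[R]_n, [/\ pwC1 c 0 1, {in `[0, 1], forall t, enorm (c t) <= r},
    c 0 = x, c 1 = y & forall t, derive1 c t = y - x].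
Proof.
move=> xr yr; pose c (t : R) := x + t *: (y - x).
have dc (t : R) : is_derive t 1 c (y - x).
  rewrite -[y - x in X in is_derive _ _ _ X]add0r; apply: is_deriveD.
  have : is_diff t ( *:%R ^~ (y - x)) ( *:%R ^~ (y - x)) by exact: is_diff_scalel.
  move=> [dd ddE]; apply: DeriveDef; first exact/derivable1_diffP.
  by rewrite -derive1E derive1E'// ddE scale1r.
have dcE t : derive1 c t = y - x by rewrite derive1E derive_val.
exists c; split => //.
- apply: (@pwC1_cons _ _ _ _ 1); [exact: ltr01| |exact: pwC1_nil].
  have cc : continuous c.
    move=> t; apply: differentiable_continuous; apply/derivable1_diffP.
    exact: ex_derive.
  split; first exact: continuous_subspaceT.
    by move=> t _; exact: ex_derive.
  exists (cst (y - x)); last by move=> t _; rewrite dcE.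
  by apply: continuous_subspaceT; exact: cst_continuous.
- move=> t; rewrite in_itv/= => /andP[t0 t1].
  have -> : c t = (1 - t) *: x + t *: y.
    by rewrite /c scalerBl scale1r scalerBr -!addrA (addrC (- _)).
  apply: (le_trans (enormD _ _)); rewrite !enormZ !ger0_norm ?subr_ge0//.
  have -> : r = (1 - t) * r + t * r by ring.
  by apply: lerD; apply: ler_wpM2l; rewrite ?subr_ge0.
- by rewrite /c scale0r addr0.
- by rewrite /c scale1r addrC subrK.
Qed.

Lemma lengths_segment N (x y : ball) (r M : R) : ball_continuous N ->
  r < 1 -> enorm (val x) <= r -> enorm (val y) <= r ->
  (forall z : 'rV[R]_n, enorm z <= r -> N z (val y - val x) <= M) ->
  exists2 l, lengths N x y l & l <= M.
Proof.
move=> cN r1 xr yr NM; have [c [h cr c0 c1 dc]] := segment_curve xr yr.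
have hb : in_ball c 0 1 by move=> t /cr /le_lt_trans; apply.
exists (\int[mu]_(t in `[0, 1]) speed N c t); first by exists 0, 1, c; split.
have iM : mu.-integrable `[0, 1] (EFin \o cst M).
  apply: continuous_compact_integrable; first exact: segment_compact.
  by apply: continuous_subspaceT; exact: cst_continuous.
have -> : M = \int[mu]_(t in `[0, 1]) cst M t.
  rewrite Rintegral_cst//= lebesgue_measure_itv/= lte_fin ltr01.
  by rewrite -EFinB subr0 /= mulr1.
apply: le_Rintegral => //; first exact: speed_integrable.
by move=> t tab; rewrite /speed dc; apply: NM; exact: cr.
Qed.

Section nonneg_integrand.
Variable N : 'rV[R]_n -> 'rV[R]_n -> R.
Hypothesis cN : ball_continuous N.
Hypothesis N_ge0 : forall (x v : 'rV[R]_n), enorm x < 1 -> 0 <= N x v.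

Lemma lengths_ge0 x y l : lengths N x y l -> 0 <= l.
Proof.
move=> [a [b [c [ab h hb e ->]]]]; apply: Rintegral_ge0 => t tab.
by apply: N_ge0; exact: hb.
Qed.

Lemma lengths_lbound x y : has_lbound (lengths N x y).
Proof. by exists 0 => l; exact: lengths_ge0. Qed.

Lemma lengths_neq0 x y : lengths N x y !=set0.
Proof.
have [r [r1 xr yr]] : exists r, [/\ r < 1, enorm (val x) <= r & enorm (val y) <= r].
  exists (Num.max (enorm (val x)) (enorm (val y))); split.
  - by rewrite gt_max (valP x) (valP y).
  - by rewrite le_max lexx.
  - by rewrite le_max lexx orbT.
have [c [h cr c0 c1 dc]] := segment_curve xr yr.
exists (\int[mu]_(t in `[0, 1]) speed N c t), 0, 1, c; split => //.
by move=> t /cr /le_lt_trans; apply.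
Qed.

Lemma lengths_inf x y : has_inf (lengths N x y).
Proof. by split; [exact: lengths_neq0|exact: lengths_lbound]. Qed.

Lemma curve_dist_ge0 x y : 0 <= curve_dist N x y.
Proof.
rewrite curve_distE; apply: lb_le_inf; first exact: lengths_neq0.
by move=> l; exact: lengths_ge0.
Qed.

Lemma curve_dist_le x y l : lengths N x y l -> curve_dist N x y <= l.
Proof. by rewrite curve_distE; apply: ge_inf; exact: lengths_lbound. Qed.

Lemma curve_dist_ge x y m : (forall l, lengths N x y l -> m <= l) ->
  m <= curve_dist N x y.
Proof.
by move=> h; rewrite curve_distE; apply: lb_le_inf => //; exact: lengths_neq0.
Qed.

Lemma curve_dist_xx x : (forall z : 'rV[R]_n, enorm z < 1 -> N z 0 = 0) ->
  curve_dist N x x = 0.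
Proof.
move=> N0; apply/eqP; rewrite eq_le curve_dist_ge0 andbT.
have [|l hl l0] := @lengths_segment N x x (enorm (val x)) 0 cN (valP x) (lexx _) (lexx _).
  by move=> z zr; rewrite subrr N0//; apply: le_lt_trans zr (valP x).
exact: le_trans (curve_dist_le hl) l0.
Qed.

Lemma lengths_cat x y z l m :
  lengths N x y l -> lengths N y z m -> lengths N x z (l + m).
Proof.
move=> [a [b [c [ab hc bc [ca cb] ->]]]] [a' [d [e [a'd he be [ea ed] ->]]]].
(* the second curve is translated so that it starts at time b *)
pose s := a' - b.
have Ea : b + s = a' by rewrite /s addrC subrK.
have Ed : (d - s) + s = d by rewrite subrK.
have bd : b < d - s by rewrite -(ltrD2r s) Ea Ed.
pose e' (t : R) := e (t + s).
have he' : pwC1 e' b (d - s) by apply: pwC1_shift; rewrite Ea Ed.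
have be' : in_ball e' b (d - s).
  move=> t; rewrite in_itv/= => tab; apply: be.
  by rewrite in_itv/= -Ea -[d]Ed !lerD2r.
pose g t := if t <= b then c t else e' t.
have gc : {in `[a, b], c =1 g}.
  by move=> t; rewrite in_itv/= /g => /andP[_ ->].
have ge : {in `[b, d - s], e' =1 g}.
  move=> t; rewrite in_itv/= /g => /andP[bt _]; case: ifP => // tb.
  have -> : t = b by apply/eqP; rewrite eq_le tb bt.
  by rewrite /e' Ea ea cb.
have hg : pwC1 g a (d - s) by apply: pwC1_cat (pwC1_eq gc hc) (pwC1_eq ge he').
have bg : in_ball g a (d - s).
  move=> t; rewrite in_itv/= => /andP[at_ td]; rewrite /g; case: (leP t b) => tb.
    by apply: bc; rewrite in_itv/= at_ tb.
  by apply: be'; rewrite in_itv/= (ltW tb) td.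
exists a, (d - s), g; split => //.
- exact: lt_trans bd.
- rewrite -(gc a) ?in_itv/= ?lexx ?ltW// -(ge (d - s)) ?in_itv/= ?lexx ?ltW//.
  by rewrite /e' Ed.
have ig := speed_integrable cN bg hg.
apply/esym/(etrans (Rintegral_itvcc_cat (ltW ab) (ltW bd) ig)).
have E1 : \int[mu]_(t in `[a, b]) speed N g t = \int[mu]_(t in `[a, b]) speed N c t.
  apply: eq_oo_Rintegral (speed_integrable cN bc hc) => t tab.
  have gco : {in `]a, b[, c =1 g}.
    by move=> u uab; apply: gc; exact: subset_itv_oo_cc.
  by rewrite /speed -(gco t tab) -(eq_oo_derive1 gco tab).
have E2 : \int[mu]_(t in `[b, d - s]) speed N g t =
    \int[mu]_(t in `[b, d - s]) speed N e' t.
  apply: eq_oo_Rintegral (speed_integrable cN be' he') => t tab.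
  have geo : {in `]b, d - s[, e' =1 g}.
    by move=> u uab; apply: ge; exact: subset_itv_oo_cc.
  by rewrite /speed -(geo t tab) -(eq_oo_derive1 geo tab).
have E3 := Rintegral_speed_shift (c := e) (m := s) (a := b) (b := d - s) cN N_ge0.
rewrite Ea Ed in E3.
exact: (congr2 +%R E1 (etrans E2 (E3 be he))).
Qed.

(** Concatenate curves whose lengths are within [e / 2] of the infima. *)
Lemma curve_dist_triangle y x z :
  curve_dist N x z <= curve_dist N x y + curve_dist N y z.
Proof.
apply/ler_addgt0Pr => e e0.
have e20 : 0 < e / 2 by rewrite divr_gt0.
have [l hl lE] := inf_adherent e20 (lengths_inf x y).
have [m hm mE] := inf_adherent e20 (lengths_inf y z).
apply: (le_trans (curve_dist_le (lengths_cat hl hm))).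
rewrite !curve_distE; move: lE mE.
set A := inf _; set B := inf _ => lE mE; lra.
Qed.

Lemma lengths_rev x y l : (forall (z v : 'rV[R]_n), N z (- v) = N z v) ->
  lengths N x y l -> lengths N y x l.
Proof.
move=> NN [a [b [c [ab h hb [ca cb] ->]]]].
exists (- b), (- a), (fun s => c (- s)); split.
- by rewrite ltrN2.
- exact: pwC1_opp.
- by move=> t tab; apply: hb; move: tab; rewrite !in_itv/= lerNl lerNr andbC.
- by rewrite !opprK.
- by apply/esym; exact: Rintegral_speed_opp.
Qed.

Lemma curve_dist_sym x y : (forall (z v : 'rV[R]_n), N z (- v) = N z v) ->
  curve_dist N x y = curve_dist N y x.
Proof.
move=> NN; rewrite !curve_distE; congr inf.
by apply/seteqP; split => l; exact: lengths_rev.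
Qed.

End nonneg_integrand.

(** Integrate [D <= N] along the curve; this is the source of the lower bounds on
    curve distances. *)
Lemma lengths_calibration N (f : 'rV[R]_n -> R) (D : 'rV[R]_n -> 'rV[R]_n -> R)
    x y l : ball_continuous N -> ball_continuous D ->
  (forall z : 'rV[R]_n, enorm z < 1 -> is_diff z f (D z)) ->
  (forall (z v : 'rV[R]_n), enorm z < 1 -> D z v <= N z v) ->
  lengths N x y l -> f (val y) - f (val x) <= l.
Proof.
move=> cN cD dfD DN [a [b [c [ab h hb [<- <-] ->]]]].
rewrite -(Rintegral_diff cD dfD hb h); apply: le_Rintegral => //.
- exact: speed_integrable.
- exact: speed_integrable.
- by move=> t tab; apply: DN; exact: hb.
Qed.

End curve_distances.

(** * The Klein and Funk distances *)

Section klein_funk_distances.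
Variables (R : realType) (n : nat).
Local Notation mu := (@lebesgue_measure R).
Local Notation ball := (unit_ball R n).
Local Notation dK := (@klein_dist R n).
Local Notation dF := (@funk_dist R n).
Implicit Types x y z : ball.

Lemma klein_norm0 (x : 'rV[R]_n) : klein_norm x 0 = 0.
Proof.
by rewrite -(scale0r (0 : 'rV[R]_n)) klein_normZ ?mul0r.
Qed.

Lemma klein_dist_ge0 x y : 0 <= dK x y.
Proof. by apply: curve_dist_ge0; exact: klein_norm_ge0. Qed.

Lemma klein_dist_xx x : dK x x = 0.
Proof.
by apply: curve_dist_xx; [exact: ball_continuous_klein|exact: klein_norm_ge0|
  move=> z _; exact: klein_norm0].
Qed.

Lemma klein_dist_sym x y : dK x y = dK y x.
Proof.
by apply: curve_dist_sym; [exact: ball_continuous_klein|exact: klein_norm_ge0|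
  exact: klein_normN].
Qed.

Lemma klein_dist_triangle y x z : dK x z <= dK x y + dK y z.
Proof.
by apply: curve_dist_triangle; [exact: ball_continuous_klein|exact: klein_norm_ge0].
Qed.

(** The two integrands differ by the exact form [dphi], whose integral only sees
    the end points of the curve. *)
Lemma lengths_funk x y l : lengths (@klein_norm R n) x y l <->
  lengths (@funk_norm R n) x y (l + phi (val y) - phi (val x)).
Proof.
suff E a b (c : R -> 'rV[R]_n) : pwC1 c a b -> in_ball c a b ->
    \int[mu]_(t in `[a, b]) speed (@funk_norm R n) c t =
    \int[mu]_(t in `[a, b]) speed (@klein_norm R n) c t + phi (c b) - phi (c a).
  split=> -[a [b [c [ab h hb [ca cb] lE]]]]; exists a, b, c; split => //.
    by rewrite lE -ca -cb; exact/esym/E.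
  have h1 := etrans lE (E _ _ _ h hb).
  by move: h1; rewrite ca cb => /addIr /addIr.
move=> h hb; rewrite -addrA -(Rintegral_diff (@ball_continuous_dphi R n)
  (@is_diff_phi R n) hb h) -RintegralD//; last 2 first.
- exact: speed_integrable (@ball_continuous_klein R n) hb h.
- exact: speed_integrable (@ball_continuous_dphi R n) hb h.
by apply: eq_Rintegral => t _; rewrite /speed funk_normE.
Qed.

Lemma funk_distE x y : dF x y = dK x y + phi (val y) - phi (val x).
Proof.
have cf := @funk_norm_ge0 R n; have ck := @klein_norm_ge0 R n.
apply/eqP; rewrite eq_le; apply/andP; split.
  rewrite -addrA -lerBlDr; apply: curve_dist_ge => l.
  by move=> /lengths_funk /(curve_dist_le cf); rewrite lerBlDr addrA.
apply: curve_dist_ge => l hl.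
rewrite -addrA -lerBrDr; apply: (curve_dist_le ck); apply/lengths_funk.
by rewrite -addrA subrK.
Qed.

Lemma symmetrized_funk_distE x y :
  symmetrized dF x y = dK x y + `|phi (val y) - phi (val x)|.
Proof.
rewrite /symmetrized !funk_distE (klein_dist_sym y x) -!addrA -addr_maxr.
by rewrite -[X in Num.max _ X]opprB maxrN.
Qed.

(** For the unit vector [u] from [x] to [y], the linear function [<u, .>] grows by
    [|y - x|] and has differential at most [|v| <= klein_norm z v]. *)
Lemma enorm_le_klein_dist x y : enorm (val y - val x) <= dK x y.
Proof.
have [->|xy] := eqVneq (enorm (val y - val x)) 0; first exact: klein_dist_ge0.
have p0 : 0 < enorm (val y - val x) by rewrite lt_neqAle eq_sym xy enorm_ge0.
pose u := (enorm (val y - val x))^-1 *: (val y - val x).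
have u1 : enorm u = 1.
  by rewrite enormZ ger0_norm ?invr_ge0 ?enorm_ge0// mulVf.
have uE : dot u (val y) - dot u (val x) = enorm (val y - val x).
  rewrite -dotNr -dotDr dotZl -enorm_sqr expr2 mulKf//.
rewrite -uE; apply: curve_dist_ge => l.
apply: (@lengths_calibration _ _ _ (dot u) (fun=> dot u)).
- exact: ball_continuous_klein.
- by move=> T f g t _ _ cg; apply: continuous_dot cg; exact: cst_continuous.
- by move=> z _; exact: is_diff_dotr.
move=> z v z1; apply: le_trans (enorm_le_klein v z1).
rewrite (le_trans (ler_norm _))// (le_trans (cauchy_schwarz _ _))//.
by rewrite u1 mul1r.
Qed.

(** Length of the segment, since [klein_norm z v <= |v| / (1 - |z|^2)]. *)
Lemma klein_dist_le x y (r : R) : r < 1 ->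
  enorm (val x) <= r -> enorm (val y) <= r ->
  dK x y <= enorm (val y - val x) / (1 - r ^+ 2).
Proof.
move=> r1 xr yr; have r0 : 0 <= r := le_trans (enorm_ge0 _) xr.
have w0 : 0 < 1 - r ^+ 2 by rewrite subr_gt0 expr_lt1.
have [z zr|l hl lM] := @lengths_segment _ _ (@klein_norm R n) x y r
  (enorm (val y - val x) / (1 - r ^+ 2)) (@ball_continuous_klein R n) r1 xr yr.
  have z1 := le_lt_trans zr r1.
  apply: (le_trans (klein_le_enorm _ z1)); apply: ler_wpM2l; first exact: enorm_ge0.
  rewrite lef_pV2 ?posrE ?defect_gt0// lerD2l lerN2 ler_sqr ?nnegrE ?enorm_ge0//.
by apply: le_trans lM; apply: curve_dist_le hl; exact: klein_norm_ge0.
Qed.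

Lemma is_metric_symmetrized_funk : is_metric (symmetrized dF).
Proof.
split.
- by move=> x; rewrite symmetrized_funk_distE klein_dist_xx subrr normr0 addr0.
- move=> x y; rewrite symmetrized_funk_distE => h.
  have k0 : dK x y = 0.
    apply/eqP; rewrite eq_le klein_dist_ge0 andbT -h lerDl.
    exact: normr_ge0.
  have e0 : enorm (val y - val x) = 0.
    by apply/eqP; rewrite eq_le enorm_ge0 andbT -k0 enorm_le_klein_dist.
  by apply/val_inj/eqP; rewrite eq_sym -subr_eq0; apply/eqP; exact: enorm_eq0.
- by move=> x y; rewrite /symmetrized maxC.
- move=> y x z; rewrite !symmetrized_funk_distE addrACA; apply: lerD.
    exact: klein_dist_triangle.
  rewrite [leRHS]addrC; apply: le_trans (ler_normD _ _).
  by rewrite addrA subrK.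
Qed.

End klein_funk_distances.

(** * Topology of the symmetrized Funk distance *)

Section metric_topology.
Variables (R : realType) (n : nat).
Local Notation dF := (@funk_dist R n).
Local Notation ds := (symmetrized dF).
Implicit Types x y p q : unit_ball R n.

Lemma enorm_le_sym_dist x y : enorm (val y - val x) <= ds x y.
Proof.
rewrite symmetrized_funk_distE; apply: (le_trans (enorm_le_klein_dist _ _)).
by rewrite lerDl.
Qed.

(** With [enorm_le_sym_dist], this identifies the metric topology with the
    Euclidean one. *)
Lemma sym_dist_near p (e : R) : 0 < e ->
  \forall v \near val p, forall q, val q = v -> ds p q < e.
Proof.
move=> e0; pose r := (1 + enorm (val p)) / 2.
have p1 := valP p; have p0 := enorm_ge0 (val p).
have r1 : r < 1 by rewrite /r; lra.
have pr : enorm (val p) < r by rewrite /r; lra.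
have w0 : 0 < 1 - r ^+ 2 by rewrite subr_gt0 expr_lt1// (le_trans p0) ?ltW.
have e20 : 0 < e / 2 by rewrite divr_gt0.
have rp : 0 < r - enorm (val p) by rewrite subr_gt0.
have cphi : phi v @[v --> val p] --> phi (val p).
  by apply: differentiable_continuous; exact: differentiable_phi.
near=> v => q qv.
have vr : enorm v <= r.
  rewrite -(subrK (val p) v) (le_trans (enormD _ _))// -lerBrDr ltW//.
  by near: v; exact: enorm_near0.
have vp : enorm (v - val p) < e / 2 * (1 - r ^+ 2).
  by near: v; apply: enorm_near0; rewrite mulr_gt0.
have phivp : `|phi v - phi (val p)| < e / 2.
  by rewrite distrC; near: v; exact: (cvgr_dist_lt _ _ cphi _ e20).
rewrite symmetrized_funk_distE qv [e in _ < e]splitr.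
apply: ltrD => //; apply: le_lt_trans (_ : enorm (v - val p) / (1 - r ^+ 2) < _).
  by rewrite -qv; apply: klein_dist_le => //; rewrite ?qv// ltW.
by rewrite ltr_pdivrMr.
Unshelve. all: by end_near. Qed.

Lemma phi_le_defect (x : 'rV[R]_n) (C : R) : enorm x < 1 -> phi x <= C ->
  expR (- (2 * C)) <= defect x.
Proof.
move=> x1 h; have w0 := defect_gt0 x1.
rewrite -[leRHS]lnK ?posrE// ler_expR; move: h; rewrite /phi -/(defect x).
by move=> h; lra.
Qed.

(** The filter is also Cauchy for the Euclidean distance, hence has a limit in the
    closed ball; a bound on [phi] is a positive lower bound on [1 - |y|^2], which
    passes to the limit. *)
Lemma sym_funk_complete (h : is_metric ds) (F : set_system (metric_of h)) :
  ProperFilter F -> cauchy F -> cvg F.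
Proof.
move=> FF Fc.
have Fex : cauchy_ex F by apply/cauchyP.
pose u (x : metric_of h) : 'rV[R]_n := val (x : unit_ball R n).
have Gc : cauchy (u @ F).
  apply: cauchy_exP => e e0; have [x Fx] := Fex e e0.
  exists (u x); suff : F (u @^-1` ball (u x) e) by [].
  apply: filterS Fx => y xy.
  rewrite /= -ball_normE /= /ball_/=; apply: le_lt_trans (mxnorm_le_enorm _) _.
  have dxy : ds x y < e by exact: xy.
  by rewrite enormB; exact: le_lt_trans (enorm_le_sym_dist _ _) dxy.
have /cvg_ex[v uv] : cvg (u @ F) by exact: cauchy_cvg.
have [x0 Fx0] := Fex 1 ltr01.
(* phi is bounded by C along the filter, which bounds the defect from below *)
pose C := phi (u x0) + 1.
have v1 : enorm v < 1.
  have : [set w : 'rV[R]_n | expR (- (2 * C)) <= defect w] v.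
    apply: (@closed_cvg _ _ F _ u _ _ _ v uv).
      apply: (@closed_comp _ _ (@defect R n) [set r | expR (- (2 * C)) <= r]).
        by move=> w _; apply: continuous_defect => ? ?.
      exact: closed_ge.
    apply: filterS Fx0 => y xy; apply: phi_le_defect; first exact: (valP y).
    rewrite /C -lerBlDl; apply: le_trans (ler_norm _) _.
    have dxy : ds x0 y < 1 by exact: xy.
    move: dxy; rewrite symmetrized_funk_distE => /ltW; apply: le_trans.
    by rewrite lerDr klein_dist_ge0.
  move=> /(lt_le_trans (expR_gt0 _)); rewrite subr_gt0.
  by rewrite expr_lt1 ?enorm_ge0.
pose p : unit_ball R n := exist _ v v1.
apply/cvg_ex; exists (p : metric_of h).
apply/fcvg_ballP => e e0.
have Fp : F [set x | forall q, val q = u x -> ds p q < e].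
  exact: (uv _ (sym_dist_near p e0)).
by apply: filterS Fp => y; apply.
Qed.

Lemma rat_row_near (v : 'rV[R]_n) (e : R) : 0 < e ->
  exists q : 'rV[rat]_n, ball v e (map_mx ratr q).
Proof.
move=> e0.
have hq (i : 'I_n) : exists q : rat, `|v ord0 i - ratr q| < e.
  have /rat_in_itvoo[q] : v ord0 i - e < v ord0 i + e by lra.
  rewrite in_itv/= => /andP[q1 q2]; exists q; rewrite ltr_norml; apply/andP.
  by split; lra.
have [f fP] := choice hq.
exists (\row_i f i); split => // i j.
by rewrite (ord1 i) !mxE; exact: fP.
Qed.

Lemma sym_funk_separable (h : is_metric ds) :
  exists2 D : set (metric_of h), countable D & dense D.
Proof.
pose g (q : 'rV[rat]_n) : unit_ball R n :=
  insubd (point : unit_ball R n) (map_mx ratr q).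
exists (range g : set (metric_of h)); 
  first exact: sub_countable (card_image_le g setT) (countableP _).
move=> O [x Ox]; rewrite openE => /(_ x Ox) /nbhs_ballP [e e0 xO].
have [e' e'0 h'] : exists2 e', 0 < e' & ball (val (x : unit_ball R n)) e' `<=`
    [set v | enorm v < 1 /\ forall q : unit_ball R n, val q = v -> ds x q < e].
  apply/nbhs_ballP; apply: filterI; last exact: sym_dist_near.
  by apply: open_nbhs_nbhs; split; [exact: open_unit_ball|exact: (valP x)].
have [q /h'[q1 qe]] := rat_row_near (val (x : unit_ball R n)) e'0.
exists (g q); split; last by exists q.
by apply: xO; apply: qe; rewrite /g val_insubd q1.
Qed.

End metric_topology.

(** * Boxes and open sets of R^n *)

Section tuple_space.
Variable R : realType.
Local Notation Rm := (measurableTypeR R).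
Implicit Types n : nat.

Definition row_of_tuple n (t : n.-tuple Rm) : 'rV[R]_n := \row_i tnth t i.

Definition tuple_box n (c : 'I_n -> R) (e : R) : set (n.-tuple Rm) :=
  [set t | forall i, `|c i - tnth t i| < e].

Lemma measurable_tuple_box n (c : 'I_n -> R) (e : R) :
  measurable (tuple_box c e).
Proof.
rewrite (_ : tuple_box c e =
    \bigcap_(i in [set: 'I_n]) ((fun t : n.-tuple Rm => tnth t i) @^-1` ball (c i) e)).
  apply: fin_bigcap_measurable => // i _.
  rewrite -[X in measurable X]setTI; apply: measurable_tnth => //.
  exact: measurable_ball.
by apply/seteqP; split => [t h i _|t h i]; [exact: h|exact: (h i I)].
Qed.

Lemma row_of_ball n (v : 'rV[R]_n) (e : R) : 0 < e ->
  @row_of_tuple n @^-1` ball v e = tuple_box (v ord0) e.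
Proof.
move=> e0; apply/seteqP; split => t /=.
  by move=> [_ h] i; have := h ord0 i; rewrite /row_of_tuple mxE.
by move=> h; split => // i j; rewrite (ord1 i) /row_of_tuple mxE; exact: h.
Qed.

(** An open set is the countable union of the boxes with rational center and
    radius [1 / (k + 1)] that it contains. *)
Lemma measurable_row_of_open n (U : set 'rV[R]_n) : open U ->
  measurable (@row_of_tuple n @^-1` U).
Proof.
move=> oU.
pose e_ (k : nat) : R := k.+1%:R^-1.
have e_gt0 k : 0 < e_ k by rewrite /e_ invr_gt0.
pose B (p : 'rV[rat]_n * nat) : set 'rV[R]_n := ball (map_mx (@ratr R) p.1) (e_ p.2).
pose F (p : 'rV[rat]_n * nat) : set (n.-tuple Rm) :=
  if `[< B p `<=` U >] then @row_of_tuple n @^-1` B p else set0.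
rewrite (_ : _ @^-1` U = \bigcup_p F p).
  apply: countable_bigcupT_measurable => // p; rewrite /F.
  case: ifP => _; last exact: measurable0.
  by rewrite /B row_of_ball//; exact: measurable_tuple_box.
apply/seteqP; split => t /=; last first.
  by move=> [p _]; rewrite /F; case: asboolP => // h; exact: h.
move=> tU; have /nbhs_ballP[e e0 tU'] : nbhs (row_of_tuple t) U.
  by apply: open_nbhs_nbhs.
have [k ke] : exists k, 2 * e_ k < e.
  exists (Num.truncn (2 / e)); rewrite /e_ ltr_pdivrMr// mulrC -ltr_pdivrMr//.
  exact: truncnS_gt.
have [q tq] := rat_row_near (row_of_tuple t) (e_gt0 k).
exists (q, k) => //; rewrite /F; case: asboolP => [_|nB].
  exact: ball_sym tq.
exfalso; apply: nB => w qw; apply: tU'.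
apply: le_ball (ltW ke) _ _; rewrite mulr_natl mulr2n.
exact: ball_triangle tq qw.
Qed.

Lemma lebesgue_tuple_box_gt0 n (c : 'I_n -> R) (e : R) : 0 < e ->
  (0 < @lebesgue_tuple R n (tuple_box c e))%E.
Proof.
move=> e0; elim: n c => [|n ih] c.
  by rewrite /= diracE mem_set ?lte01// => -[].
rewrite /= /pushforward.
rewrite (_ : _ @^-1` _ = ball (c ord0) e `*` tuple_box (c \o lift ord0) e); last first.
  apply/seteqP; split => -[s t] /=.
    move=> h; split; first by have := h ord0; rewrite tnth0.
    by move=> i; have := h (lift ord0 i); rewrite tnthS.
  move=> [h0 h] i; have [->|i0] := eqVneq i ord0; first by rewrite tnth0.
  by move: i0; rewrite eq_sym => /unlift_some[j -> _]; rewrite tnthS; exact: h.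
rewrite product_measure1E//; last 2 first.
- exact: measurable_ball.
- exact: measurable_tuple_box.
have hm : (0 < @lebesgue_measure R (ball (c ord0) e))%E.
  by rewrite lebesgue_measure_ball ?ltW// lte_fin mulrn_wgt0.
by apply: mule_gt0; [exact: hm|exact: ih].
Qed.

Lemma measurable_enorm_sqr n :
  measurable_fun setT (fun t : n.-tuple Rm => enorm (row_of_tuple t) ^+ 2).
Proof.
rewrite (_ : (fun _ => _) =
    (fun t : n.-tuple Rm => \sum_(i <- enum 'I_n) (tnth t i * tnth t i : R))).
  apply: measurable_sum => i; apply: measurable_funM; exact: measurable_tnth.
apply/funext => t; rewrite enorm_sqr /dot big_enum.
by apply: eq_bigr => i _; rewrite !mxE.
Qed.

End tuple_space.

(** * The measure on the ball *)

Section ball_measure.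
Variables (R : realType) (n : nat) (b : R).
Local Notation Rm := (measurableTypeR R).
Local Notation dF := (@funk_dist R n).
Local Notation ds := (symmetrized dF).

Definition normalization : R :=
  Gamma (n%:R / 2 + b) / (pi `^ (n%:R / 2) * Gamma b).

Definition density (t : n.-tuple Rm) : R :=
  normalization * (1 - enorm (row_of_tuple t) ^+ 2) `^ (b - 1).

Definition tuple_preimage (A : set (unit_ball R n)) : set (n.-tuple Rm) :=
  @row_of_tuple R n @^-1` (val @` A).

Lemma mu_ballE A :
  mu_ball b A = (\int[@lebesgue_tuple R n]_(t in tuple_preimage A) (density t)%:E)%E.
Proof. by []. Qed.

Lemma Gamma_ge0 (z : R) : 0 <= Gamma z.
Proof.
by apply: Rintegral_ge0 => t _; rewrite mulr_ge0 ?powR_ge0 ?expR_ge0.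
Qed.

Lemma density_ge0 t : 0 <= density t.
Proof.
by rewrite mulr_ge0 ?powR_ge0// divr_ge0 ?mulr_ge0 ?powR_ge0 ?Gamma_ge0.
Qed.

Lemma measurable_density : measurable_fun setT density.
Proof.
apply: measurable_funM; first exact: measurable_cst.
have mg : measurable_fun setT
    (fun t : n.-tuple Rm => 1 - enorm (row_of_tuple t) ^+ 2).
  by apply: measurable_funB; [exact: measurable_cst|exact: measurable_enorm_sqr].
exact: (measurableT_comp (measurable_powR (b - 1)) mg).
Qed.

Lemma open_sym_dist_row (h : is_metric ds) (U : set (metric_of h)) : open U ->
  open ((val : unit_ball R n -> 'rV[R]_n) @` U).
Proof.
move=> oU; rewrite openE => _ [p Up <-].
move: oU; rewrite openE => /(_ p Up) /nbhs_ballP[e e0 pU].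
have near1 : \forall v \near val p, enorm v < 1.
  by apply: open_nbhs_nbhs; split; [exact: open_unit_ball|exact: (valP p)].
apply: filterS2 near1 (sym_dist_near p e0) => v v1 /(_ (exist _ v v1) erefl) pv.
by exists (exist _ v v1) => //; exact: pU.
Qed.

Lemma tuple_preimage_bigcup (F : (set (unit_ball R n))^nat) :
  tuple_preimage (\bigcup_k F k) = \bigcup_k tuple_preimage (F k).
Proof. by rewrite /tuple_preimage image_bigcup preimage_bigcup. Qed.

Lemma tuple_preimageD (A B : set (unit_ball R n)) :
  tuple_preimage (A `\` B) = tuple_preimage A `\` tuple_preimage B.
Proof.
apply/seteqP; split => t /=.
  move=> [x [Ax nBx] xt]; split; first by exists x.
  by move=> [y By yt]; apply: nBx; rewrite (val_inj (etrans xt (esym yt))).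
by move=> [[x Ax xt] nB]; exists x => //; split => // Bx; apply: nB; exists x.
Qed.

Lemma measurable_tuple_preimage (h : is_metric ds) (A : set (metric_of h)) :
  <<s @open (metric_of h) >> A -> measurable (tuple_preimage A).
Proof.
apply: (@smallest_sub _ _ _ [set A | measurable (tuple_preimage A)]); last first.
  by move=> U oU; apply: measurable_row_of_open; exact: open_sym_dist_row.
have mT : measurable (tuple_preimage setT).
  rewrite (_ : tuple_preimage setT = @row_of_tuple R n @^-1` [set v | enorm v < 1]).
    by apply: measurable_row_of_open; exact: open_unit_ball.
  apply/seteqP; split => t /=; first by move=> [x _ <-]; exact: (valP x).
  by move=> t1; exists (exist (fun v : 'rV[R]_n => enorm v < 1) _ t1).
split => /=.
- by rewrite /tuple_preimage image_set0 preimage_set0.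
- by move=> B mB; rewrite tuple_preimageD; exact: measurableD.
- by move=> F mF; rewrite tuple_preimage_bigcup; exact: bigcupT_measurable.
Qed.

Section with_metric.
Variable h : is_metric ds.
Local Notation borel := (g_sigma_algebraType (@open (metric_of h))).

Definition borel_mu_ball (A : set borel) : \bar R := mu_ball b A.

Let borel_mu_ball0 : borel_mu_ball set0 = 0%E.
Proof.
by rewrite /borel_mu_ball mu_ballE /tuple_preimage image_set0 preimage_set0
  integral_set0.
Qed.

Let borel_mu_ball_ge0 A : (0 <= borel_mu_ball A)%E.
Proof.
by rewrite /borel_mu_ball mu_ballE; apply: integral_ge0 => t _;
  rewrite lee_fin density_ge0.
Qed.

Let borel_mu_ball_semi_sigma_additive : semi_sigma_additive borel_mu_ball.
Proof.
have md : measurable_fun setT (EFin \o density).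
  by apply/measurable_EFinP; exact: measurable_density.
have d0 t : (0 <= (EFin \o density) t)%E by rewrite lee_fin density_ge0.
move=> F mF tF mUF.
rewrite /borel_mu_ball mu_ballE tuple_preimage_bigcup.
apply: (semi_sigma_additive_nng_induced md d0 (F := fun k => tuple_preimage (F k))).
- by move=> k; exact: (measurable_tuple_preimage (mF k)).
- apply/trivIsetP => i j _ _ ij.
  move/trivIsetP : tF => /(_ i j Logic.I Logic.I ij) Fij.
  rewrite /tuple_preimage -preimage_setI.
  apply/seteqP; split => // t /= [[x Fx xt] [y Fy yt]].
  have : (F i `&` F j) x by split => //; rewrite (val_inj (etrans xt (esym yt))).
  by rewrite Fij.
- by apply: bigcupT_measurable => k; exact: (measurable_tuple_preimage (mF k)).
Qed.

HB.instance Definition _ := isMeasure.Build _ _ _ borel_mu_ball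
  borel_mu_ball0 borel_mu_ball_ge0 borel_mu_ball_semi_sigma_additive.

Lemma mu_ball_probability : mu_ball b [set: unit_ball R n] = 1%E ->
  exists P : probability borel R,
    forall A, <<s @open (metric_of h) >> A -> P A = mu_ball b A.
Proof.
move=> b1.
pose P : probability borel R := HB.pack borel_mu_ball
  (Measure_isProbability.Build _ _ _ borel_mu_ball b1).
by exists P.
Qed.

(** A nonempty open set contains a box, on which the density is positive; if the
    integral vanished, the box would be a null set. *)
Lemma mu_ball_full_support (U : set (metric_of h)) : 0 < normalization ->
  open U -> U !=set0 -> (0 < mu_ball b (U : set (unit_ball R n)))%E.
Proof.
move=> n0 oU [p Up]; rewrite mu_ballE.
have /nbhs_ballP[e e0 pU] : nbhs (val (p : unit_ball R n)) (val @` U).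
  by apply: open_nbhs_nbhs; split; [exact: open_sym_dist_row|exists p].
set B := tuple_preimage U.
pose C := tuple_box (val (p : unit_ball R n) ord0) e.
have CB : C `<=` B.
  by rewrite /C -row_of_ball// => t /pU.
have mB : measurable B by apply: measurable_row_of_open; exact: open_sym_dist_row.
have mC : measurable C by exact: measurable_tuple_box.
rewrite lt_neqAle eq_sym integral_ge0 ?andbT; last first.
  by move=> t _; rewrite lee_fin density_ge0.
apply/eqP => I0.
have md : measurable_fun B (EFin \o density).
  by apply: measurable_funTS; apply/measurable_EFinP; exact: measurable_density.
have ae0 : ae_eq (@lebesgue_tuple R n) B (EFin \o density) (cst 0%E).
  apply/ae_eq_integral_abs => //; rewrite -[RHS]I0; apply: eq_integral => t _.
  by rewrite /= ger0_norm// density_ge0.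
case: ae0 => N [mN N0 BN].
have : (@lebesgue_tuple R n C <= @lebesgue_tuple R n N)%E.
  apply: le_measure; rewrite ?inE//.
  move=> t Ct; apply: BN => /= Bt0; have [] := Bt0 (CB _ Ct).
  apply/eqP; rewrite gt_eqF// mulr_gt0// powR_gt0//.
  have [x _ xt] : (val @` U) (row_of_tuple t) := CB _ Ct.
  by rewrite -xt; apply: defect_gt0; exact: (valP x).
by rewrite N0 leNgt lebesgue_tuple_box_gt0.
Qed.

End with_metric.
End ball_measure.

(** * The Gamma function and the beta integral *)

Section beta_gamma.
Variable R : realType.
Local Notation mu := (@lebesgue_measure R).
Local Notation Rm := (measurableTypeR R).
Local Open Scope ereal_scope.

(** The power [w^(b-1)] extended by zero to [w <= 0]: domains such as
    [s^2 < w] then become part of the integrand, and every integral below ranges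
    over a whole space. *)
Definition ppow (b w : R) : R := if (0 < w)%R then (w `^ (b - 1))%R else 0%R.

Lemma ppow_ge0 b w : (0 <= ppow b w)%R.
Proof. by rewrite /ppow; case: ifP => _; rewrite ?powR_ge0. Qed.

Lemma measurable_ppow b : measurable_fun setT (ppow b).
Proof.
apply: measurable_fun_ifT; first exact: measurable_fun_ltr.
- exact: measurable_powR.
- exact: measurable_cst.
Qed.

(** The beta integral [B(1/2, b)], written on the interval (-1, 1). *)
Definition half_beta b : \bar R := \int[mu]_u (ppow b (1 - u ^+ 2))%:E.

(** The Gamma integral as an extended real, so that Tonelli's theorem applies
    before its convergence is known. *)
Definition eGamma b : \bar R := \int[mu]_t (ppow b t * expR (- t))%:E.

Lemma half_beta_ge0 b : 0 <= half_beta b.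
Proof. by apply: integral_ge0 => u _; rewrite lee_fin ppow_ge0. Qed.

Lemma eGamma_ge0 b : 0 <= eGamma b.
Proof.
by apply: integral_ge0 => u _; rewrite lee_fin mulr_ge0 ?ppow_ge0 ?expR_ge0.
Qed.

Lemma measurable_ppow_sqr b (w : R) :
  measurable_fun setT (fun s : Rm => ppow b (w - s ^+ 2)).
Proof.
apply: (measurableT_comp (measurable_ppow b)); apply: measurable_funB.
  exact: measurable_cst.
by apply: measurable_funX; exact: measurable_id.
Qed.

(** Substitute [s = sqrt w * u]. *)
Lemma integral_ppow_sqr b (w : R) :
  \int[mu]_s (ppow b (w - s ^+ 2))%:E = (ppow (b + 2^-1) w)%:E * half_beta b.
Proof.
have [w0|w0] := ltP 0%R w; last first.
  rewrite /ppow ltNge w0/= mul0e integral0_eq// => s _.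
  by rewrite ifF//; apply/negbTE; rewrite -leNgt subr_le0 (le_trans w0)// sqr_ge0.
pose k := Num.sqrt w; have k0 : (0 < k)%R by rewrite sqrtr_gt0.
have kw : (k ^+ 2 = w)%R by rewrite sqr_sqrtr// ltW.
have ms : measurable_fun setT (fun s : R => (ppow b (w - s ^+ 2))%:E).
  by apply/measurable_EFinP; exact: measurable_ppow_sqr.
have pos (s : R) : setT s -> 0 <= (ppow b (w - s ^+ 2))%:E.
  by rewrite lee_fin ppow_ge0.
rewrite (ge0_integral_affine 0 k0 measurableT ms pos) -/setT.
have scale (u : R) : ppow b (w - (k * u + 0) ^+ 2) =
    ((w `^ (b - 1)) * ppow b (1 - u ^+ 2))%R.
  rewrite addr0 exprMn kw -{1}[w]mulr1 -mulrBr /ppow pmulr_rgt0//.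
  case: ifP => [u0|_]; last by rewrite mulr0.
  by rewrite powRM// ltW.
under eq_integral do rewrite scale EFinM.
rewrite ge0_integralZl//; last 3 first.
- by apply/measurable_EFinP; exact: measurable_ppow_sqr.
- by move=> s _; rewrite lee_fin ppow_ge0.
- by rewrite lee_fin powR_ge0.
rewrite muleA -EFinM; congr (_%:E * _).
rewrite /ppow w0 /k -powR12_sqrt ?ltW// -powRD; last first.
  by apply/implyP => _; rewrite gt_eqF.
by congr (_ `^ _)%R; ring.
Qed.

(** Both sides compute the integral of [exp (- s^2 - t) t^(b-1)] over [t > 0]:
    in the coordinates [(s, t)] it splits, and in [(s, r = s^2 + t)] the inner
    integral is homogeneous in [r]. *)
Lemma gauss_eGamma b :
  (Num.sqrt pi)%:E * eGamma b = eGamma (b + 2^-1) * half_beta b.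
Proof.
pose f (s r : Rm) : R := (expR (- r) * ppow b (r - s ^+ 2))%R.
have f0 s r : (0 <= f s r)%R by rewrite mulr_ge0 ?expR_ge0 ?ppow_ge0.
have mf : measurable_fun setT (fun p : Rm * Rm => (f p.1 p.2)%:E).
  apply/measurable_EFinP; apply: measurable_funM.
    apply: (measurableT_comp (@measurable_expR R)).
    by apply: measurable_funN; exact: measurable_snd.
  apply: (measurableT_comp (measurable_ppow b)); apply: measurable_funB.
    exact: measurable_snd.
  by apply: measurable_funX; exact: measurable_fst.
have mfs (s : R) : measurable_fun setT (fun r : R => (f s r)%:E).
  exact: (measurableT_comp mf (measurable_pair1 s)).
have inner_t s : \int[mu]_r (f s r)%:E = (gauss_fun s)%:E * eGamma b.
  rewrite (ge0_integral_affine (s ^+ 2) ltr01 measurableT (mfs s)); last first.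
    by move=> r _; rewrite lee_fin.
  rewrite mul1e -/setT -ge0_integralZl//; last 3 first.
  - apply/measurable_EFinP/measurable_funM; first exact: measurable_ppow.
    by apply: (measurableT_comp (@measurable_expR R)); exact: measurable_funN.
  - by move=> t _; rewrite lee_fin mulr_ge0 ?ppow_ge0 ?expR_ge0.
  - by rewrite lee_fin gauss_fun_ge0.
  apply: eq_integral => t _; rewrite /f -EFinM mul1r addrK opprD expRD.
  by congr EFin; rewrite /gauss_fun; ring.
have inner_s r : \int[mu]_s (f s r)%:E =
    (ppow (b + 2^-1) r * expR (- r))%:E * half_beta b.
  rewrite mulrC EFinM -muleA -integral_ppow_sqr -ge0_integralZl//.
  - by apply/measurable_EFinP; exact: measurable_ppow_sqr.
  - by move=> t _; rewrite lee_fin ppow_ge0.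
have f0' (p : Rm * Rm) : 0 <= (f p.1 p.2)%:E by rewrite lee_fin.
have F : \int[mu]_s \int[mu]_r (f s r)%:E = \int[mu]_r \int[mu]_s (f s r)%:E.
  exact: (fubini_tonelli _ mf f0').
have mg : measurable_fun setT (fun s : R => (gauss_fun s)%:E).
  by apply/measurable_EFinP; exact: measurable_gauss_fun.
have g0 (s : R) : setT s -> 0 <= (gauss_fun s)%:E.
  by rewrite lee_fin gauss_fun_ge0.
have mG : measurable_fun setT (fun r : R => (ppow (b + 2^-1) r * expR (- r))%:E).
  apply/measurable_EFinP/measurable_funM; first exact: measurable_ppow.
  by apply: (measurableT_comp (@measurable_expR R)); exact: measurable_funN.
have G0 (r : R) : setT r -> 0 <= (ppow (b + 2^-1) r * expR (- r))%:E.
  by rewrite lee_fin mulr_ge0 ?ppow_ge0 ?expR_ge0.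
have L := ge0_integralZr mu measurableT mg g0 (eGamma_ge0 b).
have M := ge0_integralZr mu measurableT mG G0 (half_beta_ge0 b).
rewrite -integralT_gauss -L.
transitivity (\int[mu]_s \int[mu]_r (f s r)%:E).
  by apply: eq_integral => s _; rewrite inner_t.
rewrite F -M.
by apply: eq_integral => r _; rewrite inner_s.
Qed.

(** The integral over [[1 / (k + 1), 1]] is [(1 - (k + 1)^(-b)) / b]; let [k] grow. *)
Lemma integral_powR_01 (b : R) : (0 < b)%R ->
  \int[mu]_(t in `]0%R, 1%R]) (t `^ (b - 1))%:E <= b^-1%:E.
Proof.
move=> b0.
pose F (k : nat) : set R := `[(k.+1%:R^-1)%R, 1%R]%classic.
pose f (t : R) : \bar R := (t `^ (b - 1))%:E.
have mf : measurable_fun setT f.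
  by apply/measurable_EFinP; exact: measurable_powR.
have FE : \bigcup_k F k = `]0%R, 1%R]%classic.
  apply/seteqP; split => t /=.
    move=> [k _]; rewrite /F/= !in_itv/= => /andP[kt ->]; rewrite andbT.
    by apply: lt_le_trans kt; rewrite invr_gt0.
  rewrite in_itv/= => /andP[t0 t1]; exists (Num.truncn t^-1) => //.
  rewrite /F/= in_itv/= t1 andbT -[leRHS]invrK lef_pV2 ?posrE ?invr_gt0//.
  exact/ltW/truncnS_gt.
have ndF : nondecreasing_seq F.
  move=> i j ij; apply/subsetPset; rewrite /F => t /=; rewrite !in_itv/=.
  move=> /andP[it ->]; rewrite andbT; apply: le_trans it.
  by rewrite lef_pV2 ?posrE// ler_nat ltnS.
have cv : \int[mu]_(t in F k) f t @[k --> \oo] --> \int[mu]_(t in \bigcup_k F k) f t.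
  apply: ge0_nondecreasing_set_cvg_integral => //.
  - by move=> k; exact: measurable_itv.
  - by move=> k; exact: measurable_funTS.
  - by move=> k t _; rewrite lee_fin powR_ge0.
rewrite -FE -(cvg_lim _ cv)//.
apply: lime_le; first by apply/cvg_ex; eexists; exact: cv.
apply: nearW => -[|k].
  by rewrite /F invr1 set_itv1 integral_set1 lee_fin invr_ge0 ltW.
have k1 : (k.+2%:R^-1 < 1 :> R)%R by rewrite invf_lt1// ltr1n.
have k0 : (0 < k.+2%:R^-1 :> R)%R by rewrite invr_gt0.
have itvpos (t : R) : `[(k.+2%:R^-1)%R, 1%R]%classic t -> (0 < t)%R.
  by rewrite /= in_itv/= => /andP[+ _]; exact: lt_le_trans.
have dP (t : R) : (0 < t)%R -> is_derive t 1%R (fun t : R => b^-1 * t `^ b)%R (t `^ (b - 1))%R.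
  move=> t0; have := is_derive1_powR b t0 => h.
  have := @is_deriveZ _ _ _ (fun t : R => t `^ b)%R b^-1 t 1%R _ h.
  by move=> /is_derive_eq; apply; rewrite [LHS]mulrA mulVf ?mul1r// gt_eqF.
have cont (t : R) a : (0 < t)%R -> {for t, continuous (fun t : R => t `^ a)%R}.
  move=> t0; apply: differentiable_continuous; apply/derivable1_diffP.
  by have := is_derive1_powR a t0; case.
rewrite /F /f (continuous_FTC2 (F := fun t : R => (b^-1 * t `^ b)%R) k1).
- rewrite -EFinB lee_fin powR1 mulr1 lerBlDr lerDl mulr_ge0 ?powR_ge0//.
  by rewrite invr_ge0 ltW.
- apply: continuous_in_subspaceT => t /set_mem /itvpos t0; exact: cont.
- have cF : {within `[(k.+2%:R^-1)%R, 1%R], continuous (fun t : R => (b^-1 * t `^ b)%R)}.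
    apply: continuous_in_subspaceT => t /set_mem /itvpos t0.
    apply: differentiable_continuous; apply/derivable1_diffP.
    by case: (dP t t0).
  move: cF => /(continuous_within_itvP _ k1)[_ ? ?]; split => //.
  move=> t tk; have /itvpos t0 : `[(k.+2%:R^-1)%R, 1%R]%classic t.
    exact: subset_itv_oo_cc tk.
  by case: (dP t t0).
- move=> t tk; have /itvpos t0 : `[(k.+2%:R^-1)%R, 1%R]%classic t.
    exact: subset_itv_oo_cc tk.
  by case: (dP t t0) => _; rewrite -derive1E.
Qed.

(** The integrand is at most [t^(b-1)] on (0, 1], and at most a multiple of the
    exponential density of rate [1/2] beyond [1]. *)
Lemma eGamma_lty (b : R) : (0 < b)%R -> eGamma b < +oo.
Proof.
move=> b0.
(* b ln t < t / 2 + b ln (2 b), from ln x < x at x = t / (2 b) *)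
pose C : R := (2 * expR (b * ln (2 * b)))%R.
have C0 : (0 <= C)%R by rewrite mulr_ge0 ?expR_ge0.
have half0 : (0 <= 2^-1 :> R)%R by rewrite invr_ge0.
pose f1 (t : R) : R := ((fun t => t `^ (b - 1)) \_ (`]0, 1]) t)%R.
pose f2 (t : R) : R := (C * exponential_pdf 2^-1 t)%R.
have f10 t : (0 <= f1 t)%R by apply: restrict_ge0 => ? _; exact: powR_ge0.
have f20 t : (0 <= f2 t)%R by rewrite mulr_ge0// exponential_pdf_ge0.
have m1 : measurable_fun setT f1.
  apply/(measurable_restrictT _ _).1 => //.
  by apply: measurable_funTS; exact: measurable_powR.
have m2 : measurable_fun setT f2.
  apply: measurable_funM; first exact: measurable_cst.
  exact: measurable_exponential_pdf.
have le12 (t : R) : (ppow b t * expR (- t) <= f1 t + f2 t)%R.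
  rewrite /ppow; case: ifPn => [t0|_]; last by rewrite mul0r addr_ge0.
  have [t1|t1] := leP t 1%R.
    rewrite -[leLHS]addr0 lerD// /f1 patchE mem_set/= ?in_itv/= ?t0//.
    by rewrite ler_piMr ?powR_ge0// -expR0 ler_expR oppr_le0 ltW.
  rewrite -[leLHS]add0r lerD// /f2 exponential_pdfE; last exact: ltW.
  have -> : (C * (2^-1 * expR (- 2^-1 * t)) =
      expR (b * ln (2 * b) + t / 2) * expR (- t))%R.
    rewrite -expRD (_ : (_ + _ - t = b * ln (2 * b) + - 2^-1 * t)%R); last by field.
    by rewrite expRD /C; field.
  rewrite ler_wpM2r ?expR_ge0//.
  apply: (@le_trans _ _ (t `^ b)%R).
    by apply: ler_powR; [exact: ltW|rewrite gerBl].
  rewrite /powR gt_eqF// ler_expR.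
  have b2 : (0 < 2 * b)%R by rewrite mulr_gt0.
  have := ln_sublinear (divr_gt0 t0 b2).
  rewrite ln_div ?posrE// => /ltW h.
  have := ler_wpM2l (ltW b0) h; rewrite mulrBr lerBlDl => /le_trans; apply.
  by rewrite lerD2l le_eqVlt; apply/orP; left; apply/eqP; field; rewrite gt_eqF.
apply: (@le_lt_trans _ _ (\int[mu]_t (f1 t + f2 t)%:E)).
  apply: ge0_le_integral => //.
  - by move=> t _; rewrite lee_fin mulr_ge0 ?ppow_ge0 ?expR_ge0.
  - apply/measurable_EFinP/measurable_funM; first exact: measurable_ppow.
    by apply: (measurableT_comp (@measurable_expR R)); exact: measurable_funN.
  - by apply/measurable_EFinP; exact: measurable_funD.
  - by move=> t _; rewrite lee_fin.
under eq_integral do rewrite EFinD.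
rewrite ge0_integralD//; first last.
- by apply/measurable_EFinP.
- by move=> t _; rewrite lee_fin.
- by apply/measurable_EFinP.
- by move=> t _; rewrite lee_fin.
apply: lte_add_pinfty.
  apply: le_lt_trans (ltry b^-1); apply: le_trans (integral_powR_01 b0).
  rewrite [leRHS]integral_mkcond le_eqVlt; apply/orP; left; apply/eqP.
  by apply: eq_integral => t _; rewrite /f1 !patchE; case: ifP.
rewrite /f2; under eq_integral do rewrite EFinM.
rewrite ge0_integralZl//; last 2 first.
- by apply/measurable_EFinP; exact: measurable_exponential_pdf.
- by move=> t _; rewrite lee_fin exponential_pdf_ge0.
by rewrite integral_exponential_pdf ?invr_gt0// mule1 ltry.
Qed.

End beta_gamma.

(** * Total mass of the ball measure *)

Section total_mass.
Variable R : realType.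
Local Notation mu := (@lebesgue_measure R).
Local Notation Rm := (measurableTypeR R).

Lemma eGamma_gt0 (b : R) : (0 < eGamma b)%E.
Proof.
rewrite lt_neqAle eGamma_ge0 andbT eq_sym; apply/eqP => G0.
pose f (t : R) : \bar R := (ppow b t * expR (- t))%:E.
have mf : measurable_fun setT f.
  apply/measurable_EFinP/measurable_funM; first exact: measurable_ppow.
  by apply: (measurableT_comp (@measurable_expR R)); exact: measurable_funN.
have [N [mN N0 fN]] : ae_eq mu setT f (cst 0%E).
  have [+ _] := ae_eq_integral_abs mu measurableT mf; apply; rewrite -[RHS]G0.
  apply: eq_integral => t _; rewrite /f gee0_abs//.
  by rewrite lee_fin mulr_ge0 ?ppow_ge0 ?expR_ge0.
pose I01 : set R := `]0, 1[%classic.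
have : (mu I01 <= mu N)%E.
  apply: le_measure; rewrite ?inE//.
    by apply: measurable_itv.
  move=> t; rewrite /I01/= in_itv/= => /andP[t0 _]; apply: fN => /= ft.
  have [] := ft Logic.I.
  by apply/eqP; rewrite /ppow t0 gt_eqF// mulr_gt0 ?powR_gt0 ?expR_gt0.
by rewrite N0 /I01 lebesgue_measure_itv/= lte_fin ltr01 -EFinB lee_fin subr0 ler10.
Qed.

Lemma EFin_Gamma (b : R) : 0 < b -> (Gamma b)%:E = eGamma b.
Proof.
move=> b0; have GE : eGamma b =
    (\int[mu]_(t in `]0%R, +oo[) (t `^ (b - 1) * expR (- t))%:E)%E.
  rewrite [RHS]integral_mkcond; apply: eq_integral => t _.
  rewrite patchE /ppow; case: ifPn => t0.
    by rewrite mem_set//= in_itv/= t0.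
  by rewrite memNset ?mul0r//= in_itv/= andbT; exact/negP.
by rewrite /Gamma /Rintegral -GE fineK// ge0_fin_numE ?eGamma_ge0 ?eGamma_lty.
Qed.

Lemma Gamma_gt0 (b : R) : 0 < b -> 0 < Gamma b.
Proof. by move=> b0; rewrite -lte_fin EFin_Gamma// eGamma_gt0. Qed.

Lemma half_betaE (b : R) : 0 < b ->
  half_beta b = (Num.sqrt pi * Gamma b / Gamma (b + 2^-1))%:E.
Proof.
move=> b0; have b20 : 0 < b + 2^-1 by rewrite addr_gt0// invr_gt0.
have G0 := Gamma_gt0 b20; have := gauss_eGamma b.
rewrite -!EFin_Gamma// => h.
have -> : half_beta b =
    ((Gamma (b + 2^-1))^-1%:E * ((Gamma (b + 2^-1))%:E * half_beta b))%E.
  by rewrite muleA -EFinM mulVf ?gt_eqF// mul1e.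
by rewrite -h -!EFinM mulrC.
Qed.

Definition ball_integral n (b : R) : \bar R :=
  (\int[@lebesgue_tuple R n]_t (ppow b (1 - enorm (row_of_tuple t) ^+ 2))%:E)%E.

Lemma enorm_row_cons n (s : R) (t : n.-tuple Rm) :
  enorm (row_of_tuple [tuple of s :: t]) ^+ 2 =
  s ^+ 2 + enorm (row_of_tuple t) ^+ 2.
Proof.
rewrite !enorm_sqr /dot big_ord_recl /row_of_tuple !mxE tnth0 expr2.
by congr (_ + _); apply: eq_bigr => i _; rewrite !mxE tnthS.
Qed.

Lemma measurable_ball_integrand n (b : R) : measurable_fun setT
  (fun t : n.-tuple Rm => (ppow b (1 - enorm (row_of_tuple t) ^+ 2))%:E).
Proof.
apply/measurable_EFinP; apply: (measurableT_comp (measurable_ppow b)).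
by apply: measurable_funB; [exact: measurable_cst|exact: measurable_enorm_sqr].
Qed.

(** Integrate over the first coordinate [s] before the others, [t]: the integrand is
    the power [b - 1] of [w - s^2] with [w = 1 - |t|^2], and [integral_ppow_sqr]
    returns the power [b - 1/2] of [w]. *)
Lemma ball_integral_cons n (b : R) :
  ball_integral n.+1 b = (ball_integral n (b + 2^-1) * half_beta b)%E.
Proof.
pose f (t : n.+1.-tuple Rm) : \bar R :=
  (ppow b (1 - enorm (row_of_tuple t) ^+ 2))%:E.
pose cons_tuple (p : Rm * n.-tuple Rm) : n.+1.-tuple Rm := [tuple of p.1 :: p.2].
have mcons : measurable_fun setT cons_tuple.
  exact: (measurable_cons measurable_fst measurable_snd).
have mf : measurable_fun setT f by exact: measurable_ball_integrand.
have f0 t : (0 <= f t)%E by rewrite lee_fin ppow_ge0.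
have P := ge0_integral_pushforward mcons (mu \x @lebesgue_tuple R n)%E
  measurableT mf (fun t _ => f0 t).
have T := fubini_tonelli2 (m1 := mu) (m2 := @lebesgue_tuple R n)
  (f \o cons_tuple) (measurableT_comp mf mcons) (fun p => f0 (cons_tuple p)).
have M := ge0_integralZr (@lebesgue_tuple R n) measurableT
  (measurable_ball_integrand (n := n) (b + 2^-1))
  (fun t _ => ppow_ge0 (b + 2^-1) (1 - enorm (row_of_tuple t) ^+ 2))
  (half_beta_ge0 b).
apply: (etrans P); apply: (etrans T); rewrite -[RHS]M.
apply: eq_integral => t _; rewrite -integral_ppow_sqr.
apply: eq_integral => s _; rewrite /= /f enorm_row_cons.
by rewrite opprD addrA addrAC.
Qed.

Lemma ball_integralE n (b : R) : 0 < b ->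
  ball_integral n b = (pi `^ (n%:R / 2) * Gamma b / Gamma (n%:R / 2 + b))%:E.
Proof.
elim: n b => [|n ih] b b0.
  rewrite /ball_integral /= integral_dirac//; last exact: measurable_ball_integrand.
  rewrite diracT mul1e enorm_sqr /dot big_ord0 subr0 /ppow ltr01 powR1.
  by rewrite mul0r powRr0 add0r mul1r divff// gt_eqF// Gamma_gt0.
have b20 : 0 < b + 2^-1 by rewrite addr_gt0// invr_gt0.
have n0 : 0 <= n%:R / 2 :> R by rewrite divr_ge0.
have nb : 0 < n%:R / 2 + (b + 2^-1) by rewrite ltr_wpDl.
rewrite ball_integral_cons ih// half_betaE// -EFinM; congr EFin.
have -> : n.+1%:R / 2 + b = n%:R / 2 + (b + 2^-1) :> R.
  by rewrite -natr1 mulrDl mul1r -addrA (addrC b).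
have -> : n.+1%:R / 2 = n%:R / 2 + 2^-1 :> R by rewrite -natr1 mulrDl mul1r.
rewrite powRD; last by apply/implyP => _; rewrite gt_eqF// pi_gt0.
rewrite powR12_sqrt ?pi_ge0//.
have := Gamma_gt0 b20; have := Gamma_gt0 nb.
move: (Gamma (n%:R / 2 + _)) (Gamma (b + _)) => u v /lt0r_neq0 u0 /lt0r_neq0 v0.
by field; rewrite u0 v0.
Qed.

Lemma normalization_gt0 n (b : R) : 0 < b -> 0 < normalization n b.
Proof.
move=> b0; have n0 : 0 <= n%:R / 2 :> R by rewrite divr_ge0.
by rewrite divr_gt0 ?mulr_gt0 ?powR_gt0 ?pi_gt0 ?Gamma_gt0// ltr_wpDl.
Qed.

Lemma mu_ballT n (b : R) : 0 < b -> mu_ball b [set: unit_ball R n] = 1%E.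
Proof.
move=> b0; have N0 := normalization_gt0 n b0.
rewrite mu_ballE.
transitivity (\int[@lebesgue_tuple R n]_t
    ((normalization n b)%:E * (ppow b (1 - enorm (row_of_tuple t) ^+ 2))%:E))%E.
  rewrite integral_mkcond; apply: eq_integral => t _; rewrite patchE /ppow.
  have [t1|t1] := ltP (enorm (row_of_tuple t)) 1.
    rewrite (defect_gt0 t1) -EFinM mem_set//.
    by exists (exist (fun v : 'rV[R]_n => enorm v < 1) _ t1).
  rewrite memNset; last by move=> [x _ xt]; have := valP x; rewrite xt ltNge t1.
  rewrite ifF ?mule0//; apply/negbTE; rewrite -leNgt subr_le0.
  by rewrite expr_ge1 ?enorm_ge0.
have M := ge0_integralZl (@lebesgue_tuple R n) measurableT
  (measurable_ball_integrand (n := n) b)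
  (k := (normalization n b)%:E)
  (fun t _ => ppow_ge0 b (1 - enorm (row_of_tuple t) ^+ 2)).
rewrite (M _); last by rewrite lee_fin ltW.
rewrite -/(ball_integral n b) ball_integralE// -EFinM; congr EFin.
rewrite /normalization; field.
rewrite !gt_eqF ?powR_gt0 ?pi_gt0 ?Gamma_gt0//.
by rewrite ltr_wpDl// divr_ge0.
Qed.

End total_mass.

(** * The qm-spaces of the Funk distance *)

Theorem theorem2p1 (R : realType) (n : nat) (hn : (1 <= n)%N) :
  (forall x y : unit_ball R n,
    [/\ differentiable (@phi R n) (val x),
        dual_norm (klein_norm (val x)) ('d (@phi R n) (val x)) = enorm (val x),
        enorm (val x) < 1,
        funk_dist x y = klein_dist x y + phi (val y) - phi (val x) &
        symmetrized (@funk_dist R n) x y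
          = klein_dist x y + `|phi (val y) - phi (val x)|]) /\
  (forall b : R, 0 < b -> is_qm_space (@funk_dist R n) (@mu_ball R n b)) /\
  Lip1_fwd (@funk_dist R n) =
    [set (fun x => phi (val x) + g x) | g in Lip1 (@klein_dist R n)].
Proof.
split; last split.
- move=> x y; have x1 := valP x; split => //.
  + exact: differentiable_phi.
  + rewrite (_ : 'd _ _ = dphi (val x) :> (_ -> _)); first exact: dual_klein_dphi.
    by apply/funext => v; exact: diff_phi.
  + exact: funk_distE.
  + exact: symmetrized_funk_distE.
- move=> b b0; apply: (@Build_is_qm_space _ _ _ _ _ _ _ (@is_metric_symmetrized_funk R n)).
  + by move=> x y; apply: curve_dist_ge0; exact: funk_norm_ge0.
  + by move=> x; rewrite funk_distE klein_dist_xx add0r subrr.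
  + by move=> x y z; apply: curve_dist_triangle;
      [exact: ball_continuous_funk|exact: funk_norm_ge0].
  + by move=> F FF; exact: sym_funk_complete.
  + exact: sym_funk_separable.
  + by apply: mu_ball_probability; exact: mu_ballT.
  + by move=> U; apply: mu_ball_full_support; exact: normalization_gt0.
- apply/seteqP; split => [f hf|_ [g hg <-] x y] /=.
    exists (fun x => f x - phi (val x)); last first.
      by apply/funext => x; rewrite addrC subrK.
    have h x y : (f y - phi (val y)) - (f x - phi (val x)) <= klein_dist x y.
      have := hf x y; rewrite funk_distE; lra.
    move=> x y; rewrite ler_norml h andbT lerNl opprB klein_dist_sym; exact: h.
  rewrite funk_distE; have := le_trans (ler_norm _) (hg x y); lra.
Qed.
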